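(* For any $d\in\mathbb{N}$, the class of countable virtually abelian groups having an abelian subgroup of index $\leq d$ is uniformly stable with respect to the family $\{(U(n),d_{HS,n})\}_{n\geq 1}$ of unitary groups with the metrics induced by the normalized Hilbert Schmidt norms.
   Context: All groups in the class are discrete (no topology is considered on them). For $n\in\mathbb{N}$, $n\geq 1$, the normalized Hilbert Schmidt norm on $M_n(\mathbb{C})$ is $\Vert A\Vert_{HS,n}=\left(\frac1n \mathrm{Tr}(AA^* )\right)^{1/2}=\left(\frac1n\sum_{i,j}|a_{i,j}|^2\right)^{1/2}$, and it induces the bi-invariant metric $d_{HS,n}(U,V)=\Vert U-V\Vert_{HS,n}$ on the unitary group $U(n)$ of $n\times n$ unitary matrices. For a group $G$ and $\epsilon>0$, a map $\varphi:G\to U(n)$ is an $\epsilon$-homomorphism (with respect to $d_{HS,n}$) if $\Vert\varphi(g)\varphi(h)-\varphi(gh)\Vert_{HS,n}<\epsilon$ for all $g,h\in G$. A class $\mathscr{G}$ of groups is uniformly stable with respect to the family $\{(U(n),d_{HS,n})\}_{n\geq1}$ if for every $\delta>0$ there exists $\epsilon>0$ such that for every $G\in\mathscr{G}$, every $n\geq 1$ and every $\epsilon$-homomorphism $\varphi:G\to U(n)$ there is a group homomorphism $\pi:G\to U(n)$ with $\Vert\varphi(g)-\pi(g)\Vert_{HS,n}<\delta$ for all $g\in G$ (so $\epsilon$ depends only on $\delta$ and $\mathscr{G}$, not on $G$ or $n$). *)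

(* Defs.v *)
From HB Require Import structures.
From mathcomp Require Import all_boot all_order all_algebra spectral complex.
From mathcomp Require Import boolp classical_sets functions cardinality reals.
Set Implicit Arguments.
Unset Strict Implicit.
Unset Printing Implicit Defensive.
Import Order.TTheory GRing.Theory Num.Theory.
Local Open Scope classical_set_scope.
Local Open Scope ring_scope.
Local Open Scope sesquilinear_scope.

Section UnitaryGroup.
Variables (R : realType) (n : nat).

Record unitary_group := UnitaryGroup {
  unitary_val :> 'M[R[i]]_n;
  unitary_valP : unitary_val \is unitarymx }.

HB.instance Definition _ := [isSub for unitary_val].
HB.instance Definition _ := [Choice of unitary_group by <:].

Lemma unitary_mul_subproof (U V : unitary_group) :
  unitary_val U *m unitary_val V \is unitarymx.
Proof. exact: mul_unitarymx (unitary_valP U) (unitary_valP V). Qed.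

Lemma unitary_one_subproof : (1%:M : 'M[R[i]]_n) \is unitarymx.
Proof. by apply/unitarymxP; rewrite trmx1 map_mx1 mulmx1. Qed.

Lemma unitary_inv_subproof (U : unitary_group) :
  (unitary_val U)^t* \is unitarymx.
Proof. by rewrite trmxC_unitary unitary_valP. Qed.

Definition unitary_mul U V := UnitaryGroup (unitary_mul_subproof U V).
Definition unitary_one := UnitaryGroup unitary_one_subproof.
Definition unitary_inv U := UnitaryGroup (unitary_inv_subproof U).

Lemma unitary_mulA : associative unitary_mul.
Proof. by move=> U V W; apply: val_inj; rewrite /= mulmxA. Qed.

Lemma unitary_mul1g : left_id unitary_one unitary_mul.
Proof. by move=> U; apply: val_inj; rewrite /= mul1mx. Qed.

Lemma unitary_mulg1 : right_id unitary_one unitary_mul.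
Proof. by move=> U; apply: val_inj; rewrite /= mulmx1. Qed.

Lemma unitary_mulgV : right_inverse unitary_one unitary_inv unitary_mul.
Proof. by move=> U; apply: val_inj; apply/unitarymxP/unitary_valP. Qed.

Lemma unitary_mulVg : left_inverse unitary_one unitary_inv unitary_mul.
Proof.
by move=> U; apply: val_inj; apply: mulmx1C; apply/unitarymxP/unitary_valP.
Qed.

HB.instance Definition _ := isGroup.Build unitary_group
  unitary_mulA unitary_mul1g unitary_mulg1 unitary_mulVg unitary_mulgV.

(* The trace of A A^* is a nonnegative real element of R[i], so that taking its
   real part only changes its type (see hs_normE). *)
Definition hs_norm (A : 'M[R[i]]_n) : R :=
  Num.sqrt (n%:R^-1 * complex.Re (\tr (A *m A^t*))).

Lemma hs_normE (A : 'M[R[i]]_n) :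
  hs_norm A = Num.sqrt (n%:R^-1 * \sum_i \sum_j ComplexField.Normc.normc (A i j) ^+ 2).
Proof.
rewrite /hs_norm; congr (Num.sqrt (_ * _)).
have -> : \tr (A *m A^t*) = (\sum_i \sum_j ComplexField.Normc.normc (A i j) ^+ 2)%:C%C.
  rewrite /mxtrace rmorph_sum; apply: eq_bigr => i _ /=.
  rewrite mxE rmorph_sum; apply: eq_bigr => j _ /=.
  by rewrite !mxE -normCK rmorphXn.
by [].
Qed.

Definition hs_dist (U V : unitary_group) : R :=
  hs_norm (unitary_val U - unitary_val V).

End UnitaryGroup.

Definition eps_homomorphism (R : realType) (n : nat) (G : groupType) (eps : R)
    (phi : G -> unitary_group R n) : Prop :=
  forall g h : G, hs_dist (phi g * phi h)%g (phi (g * h)%g) < eps.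

Definition uniformly_stable (R : realType) (cls : groupType -> Prop) : Prop :=
  forall delta : R, 0 < delta ->
  exists2 eps : R, 0 < eps &
    forall G : groupType, cls G ->
    forall n : nat, (0 < n)%N ->
    forall phi : G -> unitary_group R n, eps_homomorphism eps phi ->
    exists pi : {multiplicative G -> unitary_group R n},
      forall g : G, hs_dist (phi g) (pi g) < delta.

Definition left_cosets (G : groupType) (H : {pred G}) : set (set G) :=
  [set [set (x * h)%g | h in [set` H]] | x in [set: G]].

Definition countable_abelian_index_le (d : nat) (G : groupType) : Prop :=
  countable [set: G] /\
  exists H : {pred G}, [/\ group_closed H,
    {in H &, forall x y, commute x y} &
    (left_cosets H #<= `I_d)%card].

(* Main.v *)
Require Import Defs.
From HB Require Import structures.
From mathcomp Require Import all_boot all_order all_algebra fingroup perm reals.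
From mathcomp Require Import spectral complex lra ring.
From mathcomp Require Import boolp classical_sets functions cardinality filter.
From mathcomp Require Import topology normedtype.

(** Let phi be an eps-homomorphism of G into the unitary n x n matrices. The
  group G is amenable, and averaging over almost invariant finite sets shows that phi
  is nearly the compression of a representation of almost the same dimension. That
  the dimension can be corrected to n is special to virtually abelian groups: every
  nonzero invariant subspace of a unitary representation contains a small one.

  Dilation. For a finite family X of elements of G, send a vector v to the function
  x |-> phi (g^-1 x)^* v on X, normalised. This gives isometries V_g of C^n into
  H = l2(X, C^n), and V_g^* V_k is eps-close to phi (g^-1 k) ([dil_gram]). If X is
  almost invariant under s, then s acts on H by a permutation operator u_s which
  nearly maps V_g to V_(s g) ([dil_shift]); hence u_s nearly commutes with the mean
  T of the projections V_x V_x^* ([dilT_commutator]). In a virtually abelian group,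
  almost invariant families come from boxes in the abelian subgroup ([folner]).

  Spectral cut. T has trace n, and the trace of T^2 is at least (1 - 2 eps) n, so that
  T is nearly a projection of rank n ([spectral_cut]). At most 3 n eigenvalues are at
  least 1/3, thus [1/3, 2/3] contains a gap whose length depends on n only
  ([spectral_gap]), and the spectral projection above the gap commutes with every u_s
  up to a constant times the commutator of T and u_s. That constant is harmless: n is
  fixed while X becomes more and more invariant. Compressing the u_s to the range of
  the projection yields matrices of size m = n + O(eps n) that are almost unitary,
  almost multiplicative and almost intertwined with phi ([approx_rep_exists]). A limit
  along an ultrafilter makes the first two properties exact ([limit_rep]): there are a
  unitary representation pi of G on C^m and a contraction W, nearly isometric, such
  that pi W is close to W phi.

  Dimension. Commuting operators have a common eigenvector, whose translates by coset
  representatives span an invariant subspace of dimension at most d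
  ([small_invariant]). Hence pi has an invariant subspace of dimension l <= n
  with m - l <= d |m - n| ([invariant_frame]), and restricting pi to it and adding
  a trivial representation gives a representation rho on C^n with an almost unitary
  almost intertwiner X ([compress_equal_dim]). The unitary part Y of X ([polar_near])
  turns rho into the representation Y^* rho Y close to phi. *)

Set Implicit Arguments.
Unset Strict Implicit.
Unset Printing Implicit Defensive.
Import Order.TTheory GRing.Theory Num.Theory.
Local Open Scope ring_scope.
Local Open Scope sesquilinear_scope.

(** * Conjugate transposes and the Frobenius norm *)

Section ConjTranspose.
Variable K : numClosedFieldType.

Lemma ctrM m n p (A : 'M[K]_(m, n)) (B : 'M_(n, p)) :
  (A *m B)^t* = B^t* *m A^t*.
Proof. by rewrite trmx_mul map_mxM. Qed.

Lemma ctrD m n (A B : 'M[K]_(m, n)) : (A + B)^t* = A^t* + B^t*.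
Proof. by rewrite linearD map_mxD. Qed.

Lemma ctrB m n (A B : 'M[K]_(m, n)) : (A - B)^t* = A^t* - B^t*.
Proof. by rewrite linearB map_mxB. Qed.

Lemma ctr1 n : (1%:M : 'M[K]_n)^t* = 1%:M.
Proof. by rewrite trmx1 map_mx1. Qed.

Lemma ctr0 m n : (0 : 'M[K]_(m, n))^t* = 0.
Proof. by rewrite trmx0 map_mx0. Qed.

Lemma ctr_sum m n (I : Type) (r : seq I) (P : pred I) (F : I -> 'M[K]_(m, n)) :
  (\sum_(i <- r | P i) F i)^t* = \sum_(i <- r | P i) (F i)^t*.
Proof. by rewrite raddf_sum raddf_sum. Qed.

Lemma mxtrace_ctr n (A : 'M[K]_n) : \tr (A^t*) = Num.conj (\tr A).
Proof. by rewrite trace_map_mx mxtrace_tr. Qed.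

End ConjTranspose.

(** Complex numbers, as a structure instead of the bare type [R[i]]: all ring
  operations on matrices are then inferred along one path. *)
Definition cplx (R : realType) : numClosedFieldType := R[i].

Section ComplexNumbers.
Variable R : realType.

Definition re (x : cplx R) : R := complex.Re x.
Definition im (x : cplx R) : R := complex.Im x.
Definition ofR (a : R) : cplx R := real_complex R a.

HB.instance Definition _ := GRing.RMorphism.copy ofR (real_complex R).

Lemma reD x y : re (x + y) = re x + re y.
Proof. by case: x y => ? ? []. Qed.

Lemma imD x y : im (x + y) = im x + im y.
Proof. by case: x y => ? ? []. Qed.

Lemma reN x : re (- x) = - re x.
Proof. by case: x. Qed.

Lemma reM x y : re (x * y) = re x * re y - im x * im y.
Proof. by case: x y => ? ? []. Qed.

Lemma imM x y : im (x * y) = re x * im y + im x * re y.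
Proof. by case: x y => a b [] c d; rewrite /im /= [b * c]mulrC. Qed.

Lemma re_conj x : re (Num.conj x) = re x.
Proof. by case: x. Qed.

Lemma im_conj x : im (Num.conj x) = - im x.
Proof. by case: x. Qed.

Lemma re_ofR a : re (ofR a) = a.
Proof. by []. Qed.

Lemma im_ofR a : im (ofR a) = 0.
Proof. by []. Qed.

Lemma cplx_eq x y : re x = re y -> im x = im y -> x = y.
Proof. by case: x y => ? ? [] ? ?; rewrite /re /im /= => -> ->. Qed.

Definition mkC (a b : R) : cplx R := Complex a b.

Lemma re_mkC a b : re (mkC a b) = a.
Proof. by []. Qed.

Lemma im_mkC a b : im (mkC a b) = b.
Proof. by []. Qed.

End ComplexNumbers.

(* From here on only the rules above are used. *)
Opaque cplx re im ofR mkC.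

Section Frobenius.
Variable R : realType.
Local Notation C := (cplx R).
Local Notation "x %:C" := (ofR x) : ring_scope.

Lemma reZ (a : R) (x : C) : re (a%:C * x) = a * re x.
Proof. by rewrite reM re_ofR im_ofR mul0r subr0. Qed.

Lemma re0 : re (0 : C) = 0.
Proof. by apply: (addrI (re (0 : C))); rewrite -reD !addr0. Qed.

Lemma re1 : re (1 : C) = 1.
Proof. by rewrite -(rmorph1 (@ofR R)) re_ofR. Qed.

Lemma re_sum (I : Type) (r : seq I) (P : pred I) (F : I -> C) :
  re (\sum_(i <- r | P i) F i) = \sum_(i <- r | P i) re (F i).
Proof. by elim/big_rec2: _ => [|i y1 y2 _ <-]; rewrite ?re0 ?reD. Qed.

Lemma conj_ofR (a : R) : Num.conj (a%:C) = a%:C.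
Proof. by apply: cplx_eq; rewrite ?re_conj // im_conj im_ofR oppr0. Qed.

Lemma ofR_re (x : C) : Num.conj x = x -> (re x)%:C = x.
Proof.
move=> xx; apply: cplx_eq; rewrite ?re_ofR // im_ofR.
by have := im_conj x; rewrite xx; lra.
Qed.

Lemma ctrZ m n (a : R) (A : 'M[C]_(m, n)) : (a%:C *: A)^t* = a%:C *: A^t*.
Proof. by apply/matrixP => i j; rewrite !mxE rmorphM /= conj_ofR. Qed.

(** The real inner product Re tr(A B^* ). It is not divided by the dimension, so
  that it suits rectangular matrices and compressions; [hs_norm_frob] restores the
  normalization. *)
Definition frob_dot m n (A B : 'M[C]_(m, n)) : R := re (\tr (A *m B^t*)).

Definition frob m n (A : 'M[C]_(m, n)) : R := Num.sqrt (frob_dot A A).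

Lemma hs_norm_frob n (A : 'M[R[i]]_n) :
  hs_norm A = Num.sqrt n%:R^-1 * frob (A : 'M[C]_n).
Proof. by rewrite /hs_norm sqrtrM // invr_ge0 ler0n. Qed.

Lemma frob_dotC m n (A B : 'M[C]_(m, n)) : frob_dot A B = frob_dot B A.
Proof.
by rewrite /frob_dot -re_conj -mxtrace_ctr ctrM trmxCK.
Qed.

Lemma frob_dotDl m n (A B D : 'M[C]_(m, n)) :
  frob_dot (A + B) D = frob_dot A D + frob_dot B D.
Proof. by rewrite /frob_dot mulmxDl mxtraceD reD. Qed.

Lemma frob_dotNl m n (A D : 'M[C]_(m, n)) : frob_dot (- A) D = - frob_dot A D.
Proof. by rewrite /frob_dot mulNmx linearN reN. Qed.

Lemma frob_dotZl m n (a : R) (A D : 'M[C]_(m, n)) :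
  frob_dot (a%:C *: A) D = a * frob_dot A D.
Proof. by rewrite /frob_dot -scalemxAl mxtraceZ reZ. Qed.

Lemma frob_dotDr m n (A B D : 'M[C]_(m, n)) :
  frob_dot D (A + B) = frob_dot D A + frob_dot D B.
Proof. by rewrite ![frob_dot D _]frob_dotC frob_dotDl. Qed.

Lemma frob_dotNr m n (A D : 'M[C]_(m, n)) : frob_dot D (- A) = - frob_dot D A.
Proof. by rewrite ![frob_dot D _]frob_dotC frob_dotNl. Qed.

Lemma frob_dotZr m n (a : R) (A D : 'M[C]_(m, n)) :
  frob_dot D (a%:C *: A) = a * frob_dot D A.
Proof. by rewrite ![frob_dot D _]frob_dotC frob_dotZl. Qed.

Definition normc2 (x : C) : R := re x ^+ 2 + im x ^+ 2.

Lemma normc2_ge0 x : 0 <= normc2 x.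
Proof. by rewrite addr_ge0 ?sqr_ge0. Qed.

Lemma re_mulconj (x : C) : re (x * Num.conj x) = normc2 x.
Proof. by rewrite reM re_conj im_conj mulrN opprK -!expr2. Qed.

Lemma normc2_eq0 (x : C) : normc2 x = 0 -> x = 0.
Proof.
move=> /eqP; rewrite paddr_eq0 ?sqr_ge0 // !sqrf_eq0 => /andP[/eqP r /eqP i].
by apply: cplx_eq; rewrite ?r ?i -(rmorph0 (@ofR R)) ?re_ofR ?im_ofR.
Qed.

Lemma frob_dotE m n (A : 'M[C]_(m, n)) :
  frob_dot A A = \sum_i \sum_j normc2 (A i j).
Proof.
rewrite /frob_dot re_sum; apply: eq_bigr => i _; rewrite mxE re_sum.
by apply: eq_bigr => j _; rewrite !mxE re_mulconj.
Qed.

Lemma frob_dot_ge0 m n (A : 'M[C]_(m, n)) : 0 <= frob_dot A A.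
Proof.
by rewrite frob_dotE; do 2![apply: sumr_ge0 => ? _]; exact: normc2_ge0.
Qed.

Lemma frob_ge0 m n (A : 'M[C]_(m, n)) : 0 <= frob A.
Proof. exact: sqrtr_ge0. Qed.

Lemma sqr_frob m n (A : 'M[C]_(m, n)) : frob A ^+ 2 = frob_dot A A.
Proof. by rewrite sqr_sqrtr ?frob_dot_ge0. Qed.

Lemma frob_le m n (A : 'M[C]_(m, n)) (a : R) :
  0 <= a -> (frob A <= a) = (frob_dot A A <= a ^+ 2).
Proof. by move=> a0; rewrite -sqr_frob ler_sqr ?nnegrE ?frob_ge0. Qed.

Lemma frob_eq0 m n (A : 'M[C]_(m, n)) : frob A = 0 -> A = 0.
Proof.
move=> a0; apply/matrixP => i j; rewrite mxE; apply/eqP.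
have : frob_dot A A = 0 by rewrite -sqr_frob a0 expr0n.
rewrite frob_dotE => /eqP; rewrite psumr_eq0; last first.
  by move=> ? _; apply: sumr_ge0 => ? _; apply: normc2_ge0.
move=> /allP /(_ i (mem_index_enum _)) /=; rewrite psumr_eq0; last first.
  by move=> ? _; apply: normc2_ge0.
by move=> /allP /(_ j (mem_index_enum _)) /= /eqP /normc2_eq0 ->.
Qed.

Lemma frob_cauchy_schwarz m n (A B : 'M[C]_(m, n)) :
  frob_dot A B <= frob A * frob B.
Proof.
have [/frob_eq0 B0|b0] := eqVneq (frob B) 0.
  by rewrite B0 /frob_dot ctr0 mulmx0 mxtrace0 mulr_ge0 ?frob_ge0.
have b_gt0 : 0 < frob B by rewrite lt_def b0 frob_ge0.
have [a0|a0] := leP (frob_dot A B) 0.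
  by rewrite (le_trans a0) // mulr_ge0 ?frob_ge0.
have ab0 : 0 <= frob A * frob B by rewrite mulr_ge0 ?frob_ge0.
suff : frob_dot A B ^+ 2 <= frob_dot A A * frob_dot B B.
  rewrite -(sqr_frob A) -(sqr_frob B) -exprMn.
  by move: (frob_dot A B) (frob A * frob B) a0 ab0 => x y x0 y0; rewrite ler_sqr // nnegrE ltW.
pose s := frob_dot A B; pose b := frob_dot B B.
have bE : 0 < b by rewrite /b -sqr_frob exprn_gt0.
(* Up to a factor, the component of A orthogonal to B. *)
have := frob_dot_ge0 (b%:C *: A - s%:C *: B).
rewrite frob_dotDl !frob_dotDr !frob_dotNl !frob_dotNr !frob_dotZl !frob_dotZr.
rewrite (frob_dotC B A) -/s -/b; set a := frob_dot A A => H.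
have {H} : 0 <= b * (a * b - s ^+ 2).
  by move: H; rewrite -/s; move: (a) (b) (s) => x y z; congr (_ <= _); ring.
by rewrite pmulr_rge0 // subr_ge0.
Qed.

Lemma frob0 m n : frob (0 : 'M[C]_(m, n)) = 0.
Proof. by rewrite /frob /frob_dot mul0mx mxtrace0 sqrtr0. Qed.

Lemma frobD m n (A B : 'M[C]_(m, n)) : frob (A + B) <= frob A + frob B.
Proof.
rewrite frob_le ?addr_ge0 ?frob_ge0 // frob_dotDl !frob_dotDr (frob_dotC B A).
have := frob_cauchy_schwarz A B; rewrite -!sqr_frob.
by move: (frob A) (frob B) (frob_dot A B) => a b s; nra.
Qed.

Lemma frobN m n (A : 'M[C]_(m, n)) : frob (- A) = frob A.
Proof. by rewrite /frob frob_dotNl frob_dotNr opprK. Qed.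

Lemma frobB m n (A B : 'M[C]_(m, n)) : frob (A - B) <= frob A + frob B.
Proof. by rewrite -(frobN B) frobD. Qed.

Lemma frobBC m n (A B : 'M[C]_(m, n)) : frob (A - B) = frob (B - A).
Proof. by rewrite -frobN opprB. Qed.

Lemma frobZ m n (a : R) (A : 'M[C]_(m, n)) : 0 <= a -> frob (a%:C *: A) = a * frob A.
Proof.
move=> a0; rewrite /frob frob_dotZl frob_dotZr mulrA -expr2 sqrtrM ?sqr_ge0 //.
by rewrite sqrtr_sqr ger0_norm.
Qed.

Lemma frob_trans m n (B A D : 'M[C]_(m, n)) :
  frob (A - D) <= frob (A - B) + frob (B - D).
Proof. by rewrite (_ : A - D = (A - B) + (B - D)) ?frobD // addrA subrK. Qed.

Lemma frob_sum m n (I : Type) (r : seq I) (P : pred I) (F : I -> 'M[C]_(m, n)) :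
  frob (\sum_(i <- r | P i) F i) <= \sum_(i <- r | P i) frob (F i).
Proof.
elim/big_rec2: _ => [|i y1 y2 _ le]; first by rewrite frob0.
by rewrite (le_trans (frobD _ _)) // lerD2l.
Qed.

Lemma frob_ctr m n (A : 'M[C]_(m, n)) : frob (A^t*) = frob A.
Proof. by rewrite /frob /frob_dot trmxCK mxtrace_mulC. Qed.

Lemma frob_dot_ctr m n (A B : 'M[C]_(m, n)) : frob_dot (A^t*) (B^t*) = frob_dot B A.
Proof. by rewrite /frob_dot trmxCK mxtrace_mulC. Qed.

Lemma frob_dot_suml m n (I : Type) (r : seq I) (P : pred I) (F : I -> 'M[C]_(m, n)) A :
  frob_dot (\sum_(i <- r | P i) F i) A = \sum_(i <- r | P i) frob_dot (F i) A.
Proof.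
elim/big_rec2: _ => [|i y1 y2 _ <-]; last by rewrite frob_dotDl.
by rewrite /frob_dot mul0mx mxtrace0 re0.
Qed.

Lemma frob_isoL m n p (E : 'M[C]_(m, n)) (A : 'M_(n, p)) :
  E^t* *m E = 1%:M -> frob (E *m A) = frob A.
Proof.
move=> EE; rewrite /frob /frob_dot ctrM mxtrace_mulC -mulmxA (mulmxA _ E) EE.
by rewrite mul1mx mxtrace_mulC.
Qed.

Lemma frob_isoR m n p (E : 'M[C]_(n, p)) (A : 'M_(m, n)) :
  E *m E^t* = 1%:M -> frob (A *m E) = frob A.
Proof.
by move=> EE; rewrite -frob_ctr ctrM frob_isoL ?frob_ctr // trmxCK.
Qed.

Lemma frob_dot_ctrL m n p (E : 'M[C]_(m, n)) (A : 'M_(n, p)) (B : 'M_(m, p)) :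
  frob_dot (E *m A) B = frob_dot A (E^t* *m B).
Proof. by rewrite /frob_dot ctrM trmxCK -mulmxA mxtrace_mulC -mulmxA. Qed.

Lemma frob_dot_ctrR m n p (E : 'M[C]_(n, p)) (A : 'M_(m, n)) (B : 'M_(m, p)) :
  frob_dot (A *m E) B = frob_dot A (B *m E^t*).
Proof. by rewrite /frob_dot ctrM trmxCK mulmxA. Qed.

(** [E *m E^t*] is the orthogonal projection onto the range of the isometry [E]. *)
Lemma frob_pythagoras m n p (E : 'M[C]_(m, n)) (A : 'M_(m, p)) :
  E^t* *m E = 1%:M ->
  frob_dot A A = frob_dot (E^t* *m A) (E^t* *m A)
               + frob_dot (A - E *m E^t* *m A) (A - E *m E^t* *m A).
Proof.
move=> EE; rewrite frob_dotDl !frob_dotDr frob_dotNl !frob_dotNr frob_dotNl.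
set B := E *m E^t* *m A; set x := frob_dot (_^t* *m _) _.
have xE : frob_dot A B = x by rewrite frob_dotC /B -mulmxA frob_dot_ctrL.
have -> : frob_dot B B = x.
  by rewrite /B -mulmxA frob_dot_ctrL (mulmxA (E^t*) E) EE mul1mx.
by rewrite (frob_dotC B A) xE; ring.
Qed.

Lemma frob_coiso_le m n p (E : 'M[C]_(m, n)) (A : 'M_(m, p)) :
  E^t* *m E = 1%:M -> frob (E^t* *m A) <= frob A.
Proof.
move=> EE; rewrite frob_le ?frob_ge0 // sqr_frob (frob_pythagoras A EE).
by rewrite lerDl frob_dot_ge0.
Qed.

Lemma frob_dot1 n : frob_dot (1%:M : 'M[C]_n) 1%:M = n%:R.
Proof. by rewrite /frob_dot ctr1 mulmx1 mxtrace1 -(rmorph_nat (@ofR R)) re_ofR. Qed.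

Lemma frob_isometry m n (E : 'M[C]_(m, n)) : E^t* *m E = 1%:M -> frob_dot E E = n%:R.
Proof. by move=> EE; rewrite /frob_dot mxtrace_mulC EE -frob_dot1 /frob_dot ctr1 mulmx1. Qed.

Lemma frob_unitary m n (U : 'M[C]_(m, n)) : U \is unitarymx -> frob U ^+ 2 = m%:R.
Proof.
move=> /unitarymxP UU; rewrite sqr_frob -frob_dot1 /frob_dot UU.
by rewrite ctr1 mulmx1.
Qed.

End Frobenius.

(** * Positive matrices and polar decomposition *)

Section Spectral.
Variable R : realType.
Local Notation C := (cplx R).
Local Notation "x %:C" := (ofR x) : ring_scope.

Definition rdiag n (t : 'I_n -> R) : 'M[C]_n := diag_mx (\row_i (t i)%:C).

Lemma rdiagM n (s t : 'I_n -> R) : rdiag s *m rdiag t = rdiag (fun i => s i * t i).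
Proof.
rewrite /rdiag mulmx_diag; congr diag_mx; apply/rowP => i.
by rewrite !mxE rmorphM.
Qed.

Lemma rdiag1 n : rdiag (fun _ : 'I_n => 1) = 1%:M.
Proof.
by apply/matrixP => i j; rewrite !mxE rmorph1.
Qed.

Lemma rdiagB n (s t : 'I_n -> R) : rdiag s - rdiag t = rdiag (fun i => s i - t i).
Proof. by apply/matrixP => i j; rewrite !mxE -mulrnBl rmorphB. Qed.

Lemma ctr_rdiag n (t : 'I_n -> R) : (rdiag t)^t* = rdiag t.
Proof.
rewrite /rdiag tr_diag_mx map_diag_mx; congr diag_mx.
by apply/rowP => i; rewrite !mxE; exact: conj_ofR.
Qed.

Lemma eq_rdiag n (s t : 'I_n -> R) : s =1 t -> rdiag s = rdiag t.
Proof. by move=> st; congr diag_mx; apply/rowP => i; rewrite !mxE st. Qed.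

Lemma frob_rdiag n (t : 'I_n -> R) :
  frob_dot (rdiag t) (rdiag t) = \sum_i t i ^+ 2.
Proof.
rewrite /frob_dot ctr_rdiag rdiagM re_sum; apply: eq_bigr => i _.
by rewrite !mxE eqxx expr2.
Qed.

Lemma rdiagE n (t : 'I_n -> R) : rdiag t = diag_mx (\row_i (t i)%:C).
Proof. by []. Qed.

Opaque rdiag.

(** The diagonal entries of [P *m A *m P^t*] are values of the quadratic form of
  [A] at the rows of [P], hence real and nonnegative. *)
Lemma psd_spectral n (A : 'M[C]_n) :
    A^t* = A -> (forall v : 'rV_n, 0 <= frob_dot (v *m A) v) ->
  exists2 P : 'M[C]_n, P \is unitarymx &
  exists2 t : 'I_n -> R, forall i, 0 <= t i & A = P^t* *m rdiag t *m P.
Proof.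
move=> Ah Apos; exists (spectralmx A); first exact: spectral_unitarymx.
have Pu := spectral_unitarymx A; set P := spectralmx A in Pu *.
have PP := unitarymxP Pu; have PP' := mulmx1C PP.
have : A \is normalmx by apply/normalmxP; rewrite Ah.
move=> /orthomx_spectralP; rewrite invmx_unitary // -/P; set D := spectral_diag A => AE.
have DE : diag_mx D = P *m A *m P^t*.
  by rewrite AE !mulmxA PP mul1mx -!mulmxA PP mulmx1.
have Dpos i : 0 <= re (D 0 i).
  have -> : D 0 i = (row i P *m A *m (row i P)^t*) 0 0.
    transitivity ((P *m A *m P^t*) i i); first by rewrite -DE !mxE eqxx mulr1n.
    by rewrite -row_mul !mxE; apply: eq_bigr => k _; rewrite !mxE.
  by have := Apos (row i P); rewrite /frob_dot trace_mx11.
have Dreal i : (re (D 0 i))%:C = D 0 i.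
  apply: ofR_re.
  have : (diag_mx D)^t* = diag_mx D by rewrite DE !ctrM trmxCK Ah mulmxA.
  by move=> /(congr1 (fun X : 'M_n => X i i)); rewrite !mxE eqxx !mulr1n.
have DD : rdiag (fun i => re (D 0 i)) = diag_mx D.
  by rewrite rdiagE; congr diag_mx; apply/rowP => i; rewrite mxE Dreal.
by exists (fun i => re (D 0 i)); [exact: Dpos | rewrite DD; exact: AE].
Qed.

Lemma frob_conjB n (P A B : 'M[C]_n) : P \is unitarymx ->
  frob (P^t* *m A *m P - P^t* *m B *m P) = frob (A - B).
Proof.
move=> /unitarymxP PP; rewrite -mulmxBl -mulmxBr (frob_isoR _ PP).
by apply: frob_isoL; rewrite trmxCK.
Qed.

Lemma rdiag_conjM n (P : 'M[C]_n) (s t : 'I_n -> R) : P \is unitarymx ->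
  P^t* *m rdiag s *m P *m (P^t* *m rdiag t *m P) =
  P^t* *m rdiag (fun i => s i * t i) *m P.
Proof.
move=> /unitarymxP PP.
by rewrite -rdiagM !mulmxA -[_ *m P *m P^t*]mulmxA PP mulmx1.
Qed.

(** The unitary part U of the polar decomposition X = U S. In an eigenbasis of
  S the bound reads (s - 1)^2 <= (s^2 - 1)^2 for s > 0. *)
Lemma polar_unitmx n (X : 'M[C]_n) : X \in unitmx ->
  exists2 U : 'M[C]_n, U \is unitarymx & frob (X - U) <= frob (X^t* *m X - 1%:M).
Proof.
move=> Xu; set A := X^t* *m X.
have Apos (v : 'rV_n) : 0 <= frob_dot (v *m A) v.
  by rewrite /A mulmxA frob_dot_ctrR frob_dot_ge0.
have [|P Pu [t t0 AE]] := psd_spectral _ Apos; first by rewrite /A ctrM trmxCK.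
have PP := unitarymxP Pu; have PP' := mulmx1C PP.
have tpos i : 0 < t i.
  rewrite lt_def t0 andbT; apply/negP => /eqP ti0.
  have : \det (rdiag t) != 0.
    have Au : A \in unitmx.
      by rewrite unitmx_mul Xu andbT map_unitmx unitmx_tr.
    move: Au; rewrite AE !unitmxE !det_mulmx !unitrM => /andP[/andP[_ +] _].
    by rewrite unitfE.
  rewrite rdiagE det_diag prodf_seq_neq0 => /allP /(_ i (mem_index_enum _)) /=.
  by rewrite mxE ti0 eqxx.
pose s i := Num.sqrt (t i).
have ssq i : s i * s i = t i by rewrite -expr2 sqr_sqrtr.
have spos i : 0 < s i by rewrite sqrtr_gt0.
pose S := P^t* *m rdiag s *m P; pose S' := P^t* *m rdiag (fun i => (s i)^-1) *m P.
have SS' : S' *m S = 1%:M.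
  rewrite /S' /S (rdiag_conjM _ _ Pu).
  by under eq_rdiag do [rewrite mulVf ?gt_eqF //]; rewrite rdiag1 mulmx1.
have ASS : A = S *m S.
  by rewrite /S (rdiag_conjM _ _ Pu) (eq_rdiag ssq); exact: AE.
have S'h : S'^t* = S'.
  rewrite /S' (ctrM (_ *m _) P) (ctrM (P^t*)) trmxCK ctr_rdiag.
  exact: mulmxA.
pose U := X *m S'.
have UU : U^t* *m U = 1%:M.
  rewrite /U ctrM S'h mulmxA -(mulmxA S') -/A ASS mulmxA SS' mul1mx.
  exact: mulmx1C.
exists U; first by apply/unitarymxP/mulmx1C.
have -> : X - U = U *m (S - 1%:M) by rewrite mulmxBr mulmx1 -[U *m S]mulmxA SS' mulmx1.
rewrite (frob_isoL _ UU) AE.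
have I1 : 1%:M = P^t* *m rdiag (fun=> 1) *m P by rewrite rdiag1 mulmx1 PP'.
have E1 u : frob (P^t* *m rdiag u *m P - 1%:M) = frob (rdiag u - rdiag (fun=> 1)).
  by rewrite I1; exact: frob_conjB.
rewrite [leLHS]E1 [leRHS]E1 !rdiagB.
rewrite frob_le ?frob_ge0 //.
rewrite sqr_frob !frob_rdiag; apply: ler_sum => i _.
have := ssq i; have := spos i; set y := s i => y0 <-.
have -> : (y * y - 1) ^+ 2 = (y - 1) ^+ 2 * (y + 1) ^+ 2 by ring.
by rewrite ler_peMr ?sqr_ge0 // expr2; nra.
Qed.

(** Shifting by [s] gives a singular matrix only if [s] is an eigenvalue of [- X],
  and there are at most [n] of those among the [n + 1] candidates [e / k]. *)
Lemma unitmx_shift n (X : 'M[C]_n) (e : R) : 0 < e ->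
  exists s : R, [/\ 0 < s, s <= e & X + (s%:C)%:M \in unitmx].
Proof.
move=> e0; apply: contrapT => H.
pose s k : R := e / k.+1%:R.
have s0 k : 0 < s k by rewrite divr_gt0.
have rt k : root (char_poly (- X)) (s k)%:C.
  rewrite -eigenvalue_root_char; apply: contrapT => /negP neig.
  apply: H; exists (s k); split=> //.
    by rewrite ler_pdivrMr // ler_peMr ?(ltW e0) // ler1n.
  move: neig; rewrite /eigenvalue /eigenspace kermx_eq0 negbK -row_free_unit.
  by rewrite /row_free -mxrank_opp opprD opprK opprK.
have := @max_poly_roots _ (char_poly (- X)) [seq (s k)%:C | k <- iota 0 n.+1].
rewrite size_map size_iota size_char_poly ltnn => F; apply/notF/F.
- by rewrite -size_poly_eq0 size_char_poly.
- by apply/allP => _ /mapP[k _ ->]; exact: rt.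
rewrite map_inj_uniq ?iota_uniq // => i j /(fmorph_inj (@ofR R)) /(mulfI (lt0r_neq0 e0)).
by move=> /invr_inj /eqP; rewrite eqr_nat => /eqP[].
Qed.

(** For singular X, the polar decomposition is taken after adding a small
  scalar to X. *)
Lemma polar_near n (X : 'M[C]_n) (e : R) : 0 < e ->
  exists2 U : 'M[C]_n, U \is unitarymx &
    frob (X - U) <= frob (X^t* *m X - 1%:M) + e.
Proof.
move=> e0; pose q := Num.sqrt (n%:R : R); pose K x q : R := 1 + 2 * x + 2 * q.
have fX := frob_ge0 X; have q0 : 0 <= q := sqrtr_ge0 _.
have K0 : 0 < K (frob X) q by rewrite /K; lra.
have [|s [s0 se Yu]] := unitmx_shift X (_ : 0 < Num.min 1 (e / K (frob X) q)).
  by rewrite lt_min ltr01 divr_gt0.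
move: se; rewrite le_min ler_pdivlMr // => /andP[s1 sK].
have {Yu} [U Uu le] := polar_unitmx Yu; exists U => //.
set Y := X + _ in le *; pose I : 'M[C]_n := 1%:M.
have YE : Y = X + s%:C *: I by rewrite scalemx1.
have fI : frob I = q by rewrite /frob frob_dot1.
have h1 : frob (X - Y) = s * q.
  by rewrite YE opprD addNKr frobN frobZ ?ltW // fI.
have h2 : frob (Y^t* *m Y - I) <= frob (X^t* *m X - I) + (s * (2 * frob X) + s * s * q).
  have -> : Y^t* *m Y - I = (X^t* *m X - I) + (s%:C *: (X + X^t*) + s%:C *: (s%:C *: I)).
    rewrite YE ctrD ctrZ ctr1 mulmxDl !mulmxDr -!scalemxAl -!scalemxAr.
    by rewrite mulmx1 !mul1mx; apply/matrixP => i j; rewrite !mxE; ring.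
  rewrite (le_trans (frobD _ _)) // lerD2l (le_trans (frobD _ _)) //.
  rewrite !frobZ ?(ltW s0) // fI mulrA lerD2r ler_wpM2l ?(ltW s0) //.
  by rewrite (le_trans (frobD _ _)) // frob_ctr mulr_natl mulr2n.
rewrite (le_trans (frob_trans Y _ _)) // h1.
rewrite (le_trans (lerD (lexx (s * q)) (le_trans le h2))) // addrCA lerD2l.
move: (frob X) (q) s0 s1 q0 sK; rewrite /K; clear=> x {}q s0 s1 q0 sK.
have : s * s * q <= s * q by rewrite ler_wpM2r // ler_piMl // ltW.
by lra.
Qed.

End Spectral.

(** * Cutting at a spectral gap *)

Section Cut.
Variable R : realType.
Local Notation C := (cplx R).
Local Notation "x %:C" := (ofR x) : ring_scope.

(** The spectral gap: at most [3 n] of the [t i] are at least 1/3, so that one of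
  [3 n + 1] disjoint subintervals of [1/3, 2/3] contains none of them. *)
Lemma spectral_gap (I : finType) (n : nat) (t : I -> R)
    (g : R := (3 * (3 * n + 1)%N%:R)^-1) :
    (forall i, 0 <= t i) -> \sum_i t i = n%:R ->
  exists l : R, [/\ 3^-1 <= l, l + g <= 2 / 3 &
    forall i, t i <= l \/ l + g <= t i].
Proof.
move=> t0 tn; pose M := (3 * n + 1)%N; pose l (j : 'I_M) : R := 3^-1 + j%:R * g.
have M0 : (0 : R) < M%:R by rewrite ltr0n /M addn1.
have g0 : 0 < g by rewrite invr_gt0 mulr_gt0 // ltr0n.
have Mg : M%:R * g = 3^-1 by rewrite /g -/M invfM mulrCA divff ?mulr1 // gt_eqF.
apply: contrapT => H.
have hit (j : 'I_M) : exists i, l j < t i < l j + g.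
  apply: contrapT => nohit; apply: H; exists (l j); split.
  - by rewrite lerDl mulr_ge0 // ltW.
  - have : j%:R * g + g <= M%:R * g.
      by rewrite -[X in _ + X]mul1r -mulrDl ler_wpM2r ?(ltW g0) // natr1 ler_nat.
    by rewrite Mg /l; lra.
  - move=> i; have [?|lt] := leP (t i) (l j); first by left.
    by right; rewrite leNgt; apply/negP => lt2; apply: nohit; exists i; rewrite lt.
pose f j := xchoose (hit j).
have fP j : l j < t (f j) < l j + g := xchooseP (hit j).
have lejg (j k : 'I_M) : (j < k)%N -> l j + g <= l k.
  move=> jk; rewrite /l -addrA lerD2l -[X in _ + X]mul1r -mulrDl natr1.
  by rewrite ler_wpM2r ?(ltW g0) // ler_nat.
have finj : injective f.
  move=> j k jk; apply: contrapT => /eqP /=; rewrite -(inj_eq val_inj) neq_ltn.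
  have := fP j; have := fP k; rewrite jk => /andP[k1 k2] /andP[j1 j2].
  by by move=> /orP[/lejg|/lejg]; lra.
have : \sum_(j < M) (3^-1 : R) <= n%:R.
  rewrite -tn; apply: (@le_trans _ _ (\sum_(j < M) t (f j))).
    apply: ler_sum => j _; have /andP[+ _] := fP j; move/ltW; apply: le_trans.
    by rewrite /l lerDl mulr_ge0 // ltW.
  rewrite -(big_imset t (h := f) (A := predT)) /=; last by move=> x y _ _; apply: finj.
  rewrite [leRHS](bigID (mem (f @: predT))) /= lerDl; exact: sumr_ge0.
rewrite sumr_const card_ord -[leLHS]mulr_natl /M natrD natrM; lra.
Qed.

Lemma normc2_ofRM (a : R) (x : C) : normc2 (a%:C * x) = a ^+ 2 * normc2 x.
Proof. by rewrite /normc2 reM imM re_ofR im_ofR !mul0r subr0 addr0 !exprMn mulrDr. Qed.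

Lemma normc2_bool (b : bool) : normc2 (b%:R : C) = b%:R.
Proof.
have -> : b%:R = (b%:R : R)%:C by rewrite rmorph_nat.
by rewrite /normc2 re_ofR im_ofR; case: b => /=; ring.
Qed.

Lemma rdiag_mull m n (t : 'I_m -> R) (A : 'M[C]_(m, n)) i j :
  (rdiag t *m A) i j = (t i)%:C * A i j.
Proof. by rewrite rdiagE mul_diag_mx !mxE. Qed.

Lemma rdiag_mulr m n (t : 'I_n -> R) (A : 'M[C]_(m, n)) i j :
  (A *m rdiag t) i j = (t j)%:C * A i j.
Proof. by rewrite rdiagE mul_mx_diag !mxE mulrC. Qed.

Lemma le_frob m n p q (A : 'M[C]_(m, n)) (B : 'M[C]_(p, q)) (k : R) : 0 <= k ->
  frob_dot A A <= k ^+ 2 * frob_dot B B -> frob A <= k * frob B.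
Proof.
move=> k0 le; rewrite frob_le ?mulr_ge0 ?frob_ge0 //.
by rewrite exprMn sqr_frob.
Qed.

(** If the rows of [P] are an orthonormal eigenbasis, these columns span the sum of
  the eigenlines in [I]. *)
Definition sel_cols h (P : 'M[C]_h) (I : {set 'I_h}) : 'M[C]_(h, #|I|) :=
  (rowsub (fun k : 'I_#|I| => enum_val k) P)^t*.

Lemma sel_cols_iso h (P : 'M[C]_h) (I : {set 'I_h}) : P \is unitarymx ->
  (sel_cols P I)^t* *m sel_cols P I = 1%:M.
Proof.
move=> /unitarymxP PP; rewrite /sel_cols trmxCK; apply/matrixP => a b.
transitivity ((P *m P^t*) (enum_val a) (enum_val b)).
  by rewrite !mxE; apply: eq_bigr => k _; rewrite !mxE.
by rewrite PP !mxE (inj_eq enum_val_inj).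
Qed.

Lemma sel_cols_proj h (P : 'M[C]_h) (I : {set 'I_h}) :
  sel_cols P I *m (sel_cols P I)^t* =
  P^t* *m rdiag (fun i => (i \in I)%:R) *m P.
Proof.
apply/matrixP => a b; rewrite /sel_cols trmxCK !mxE.
transitivity (\sum_(i in I) Num.conj (P i a) * P i b).
  rewrite [RHS]big_enum_val /=; apply: eq_bigr => k _; by rewrite !mxE.
rewrite [LHS]big_mkcond /=; apply: eq_bigr => i _.
rewrite rdiag_mulr !mxE; case: (i \in I); rewrite ?rmorph1 ?rmorph0.
  by rewrite mul1r.
by rewrite !mul0r.
Qed.

Lemma frob_conj n (P : 'M[C]_n) (A : 'M[C]_n) : P \is unitarymx ->
  frob_dot (P *m A *m P^t*) (P *m A *m P^t*) = frob_dot A A.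
Proof.
move=> /unitarymxP PP; have PP' := mulmx1C PP.
rewrite -!sqr_frob (frob_isoR (E := P^t*)); last by rewrite trmxCK.
by rewrite (frob_isoL A PP').
Qed.

(** In the eigenbasis [P], the commutator of [u] with the diagonal operator [T] has
  the entries [(t j - t i) * u i j], and the same holds for [S]. *)
Lemma cut_commutator h (P : 'M[C]_h) (t s : 'I_h -> R) (k : R) (u : 'M[C]_h)
    (T := P^t* *m rdiag t *m P) (S := P^t* *m rdiag s *m P) :
    P \is unitarymx -> 0 <= k ->
    (forall i j, (s i - s j) ^+ 2 <= k ^+ 2 * (t i - t j) ^+ 2) ->
  frob (u *m S - S *m u) <= k * frob (u *m T - T *m u).
Proof.
move=> Pu k0 st; apply: le_frob => //; pose u' := P *m u *m P^t*.
have PP := unitarymxP Pu; have PP' := mulmx1C PP.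
have comm r : P *m (u *m (P^t* *m rdiag r *m P) - (P^t* *m rdiag r *m P) *m u) *m P^t*
    = u' *m rdiag r - rdiag r *m u'.
  have c1 : P *m (u *m (P^t* *m rdiag r *m P)) *m P^t* = u' *m rdiag r.
    by rewrite /u' !mulmxA -[LHS]mulmxA PP mulmx1.
  have c2 : P *m (P^t* *m rdiag r *m P *m u) *m P^t* = rdiag r *m u'.
    by rewrite /u' !mulmxA PP mul1mx.
  by rewrite mulmxBr mulmxBl c1 c2.
have e r : let D := u *m (P^t* *m rdiag r *m P) - (P^t* *m rdiag r *m P) *m u in
    frob_dot D D = \sum_i \sum_j normc2 ((u' *m rdiag r - rdiag r *m u') i j).
  by rewrite /= -frob_dotE -comm frob_conj.
rewrite [leLHS](e s) [X in _ <= _ * X](e t) mulr_sumr; apply: ler_sum => i _.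
rewrite mulr_sumr; apply: ler_sum => j _.
have entry r : (u' *m rdiag r - rdiag r *m u') i j = (r j - r i)%:C * u' i j.
  by rewrite mxE [X in _ + X]mxE rdiag_mulr rdiag_mull -mulrBl -rmorphB.
rewrite [X in normc2 X <= _]entry [X in _ <= _ * normc2 X]entry.
move: (u' i j) (st j i) => x le.
by rewrite !normc2_ofRM mulrA ler_wpM2r ?normc2_ge0.
Qed.

Lemma cut_bound h p (P : 'M[C]_h) (t s : 'I_h -> R) (k : R) (u : 'M[C]_(p, h))
    (T := P^t* *m rdiag t *m P) (S := P^t* *m rdiag s *m P) :
    P \is unitarymx -> 0 <= k ->
    (forall i, s i ^+ 2 <= k ^+ 2 * t i ^+ 2) ->
  frob (u *m S) <= k * frob (u *m T).
Proof.
move=> Pu k0 st; have PP := unitarymxP Pu.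
have fE r : frob (u *m (P^t* *m rdiag r *m P)) = frob (u *m P^t* *m rdiag r).
  by rewrite !mulmxA (frob_isoR _ PP).
rewrite [leLHS]fE [X in _ <= _ * X]fE.
apply: le_frob => //; rewrite !frob_dotE mulr_sumr; apply: ler_sum => i _.
rewrite mulr_sumr; apply: ler_sum => j _.
by rewrite !rdiag_mulr !normc2_ofRM mulrA ler_wpM2r ?normc2_ge0.
Qed.

(** Both sides are the weight of [V] along the [i]-th vector of the orthonormal basis [P]. *)
Lemma row_weight h n (P : 'M[C]_h) (V : 'M[C]_(h, n)) i :
  frob (V^t* *m (row i P)^t*) ^+ 2 = \sum_j normc2 ((P *m V) i j).
Proof.
rewrite -ctrM frob_ctr -row_mul sqr_frob frob_dotE big_ord1.
by apply: eq_bigr => j _; rewrite [X in normc2 X = _]mxE.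
Qed.

Lemma unitary_row h (P : 'M[C]_h) i : P \is unitarymx ->
  P *m (row i P)^t* = col i 1%:M.
Proof. by move=> /unitarymxP PP; rewrite tr_row map_col !colE mulmxA PP. Qed.

Lemma row_isometry_le1 h n (P : 'M[C]_h) (V : 'M[C]_(h, n)) i :
  P \is unitarymx -> V^t* *m V = 1%:M ->
  \sum_j normc2 ((P *m V) i j) <= 1.
Proof.
move=> Pu VV; rewrite -row_weight.
have rr : frob ((row i P)^t*) ^+ 2 = 1.
  rewrite frob_ctr sqr_frob /frob_dot trace_mx11.
  have -> : row i P *m (row i P)^t* = row i (P *m (row i P)^t*) by rewrite row_mul.
  by rewrite unitary_row // !mxE eqxx re1.
by rewrite -rr ler_sqr ?nnegrE ?frob_ge0 // frob_coiso_le.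
Qed.

Lemma frob_dot_rdiag h n (t : 'I_h -> R) (A : 'M[C]_(h, n)) :
  frob_dot (rdiag t *m A) A = \sum_i t i * \sum_j normc2 (A i j).
Proof.
rewrite /frob_dot -mulmxA re_sum; apply: eq_bigr => i _.
rewrite rdiag_mull reZ mxE re_sum; congr (_ * _).
by apply: eq_bigr => j _; rewrite !mxE re_mulconj.
Qed.

(** The isometries [V b] have nearly the same range, as their mutual products are
  nearly unitary. Thus their mean projection [T] has eigenvalues [t i] in [0, 1] with
  [\sum_i t i = n] and [\sum_i t i * (1 - t i) <= k * n]. Cutting at a gap inside
  [1/3, 2/3] costs a factor 3 only, because the distance of [t i] to its rounding
  to 0 or 1 is at most [3 * t i * (1 - t i)]; [V1] has the weights [w i] along the
  eigenvectors with [\sum_i t i * w i >= (1 - k) * n] and so it loses at most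
  [3 * k * n] too. The constant [K] is the inverse of the length of the gap. *)
Lemma spectral_cut h n (B : finType) (V : B -> 'M[C]_(h, n)) (V1 : 'M[C]_(h, n))
    (k : R) (T : 'M[C]_h := (#|B|%:R^-1)%:C *: \sum_b V b *m (V b)^t*)
    (K : R := 3 * (3 * n + 1)%N%:R) :
    (0 < #|B|)%N ->
    (forall b, (V b)^t* *m V b = 1%:M) -> V1^t* *m V1 = 1%:M ->
    (forall b b', (1 - k) * n%:R <= frob ((V b)^t* *m V b') ^+ 2) ->
    (forall b, (1 - k) * n%:R <= frob ((V b)^t* *m V1) ^+ 2) ->
  exists m, exists E : 'M[C]_(h, m),
  [/\ E^t* *m E = 1%:M,
      `|m%:R - n%:R| <= 3 * k * n%:R,
      frob (V1 - E *m E^t* *m V1) ^+ 2 <= 3 * k * n%:R,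
      (forall u : 'M_h, frob (u *m (E *m E^t*) - E *m E^t* *m u)
         <= K * frob (u *m T - T *m u)) &
      forall p (u : 'M_(p, h)), frob (u *m E) <= 3 * frob (u *m T)].
Proof.
move=> B0 Viso V1iso VV VV1.
have q0 : (0 : R) < #|B|%:R by rewrite ltr0n.
have qi0 : (0 : R) <= #|B|%:R^-1 by rewrite invr_ge0 ltW.
have avg_ge (F : B -> R) x : (forall b, x <= F b) -> x <= #|B|%:R^-1 * \sum_b F b.
  move=> xF; rewrite mulrC ler_pdivlMr // mulr_natr -sumr_const.
  by apply: ler_sum => b _.
have avg_le (F : B -> R) x : (forall b, F b <= x) -> #|B|%:R^-1 * \sum_b F b <= x.
  move=> xF; rewrite mulrC ler_pdivrMr // mulr_natr -sumr_const.
  by apply: ler_sum => b _.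
have dotT p (A : 'M_(h, p)) :
    frob_dot (T *m A) A = #|B|%:R^-1 * \sum_b frob ((V b)^t* *m A) ^+ 2.
  rewrite /T -scalemxAl frob_dotZl mulmx_suml frob_dot_suml; congr (_ * _).
  by apply: eq_bigr => b _; rewrite -mulmxA frob_dot_ctrL sqr_frob.
have Th : T^t* = T.
  rewrite ctrZ ctr_sum; congr (_ *: _); apply: eq_bigr => b _.
  by rewrite ctrM trmxCK.
have Tpos (v : 'rV_h) : 0 <= frob_dot (v *m T) v.
  rewrite -frob_dot_ctr ctrM Th frob_dotC dotT mulr_ge0 // sumr_ge0 // => b _.
  exact: sqr_ge0.
have [P Pu [t t0 TE]] := psd_spectral Th Tpos.
have PP := unitarymxP Pu; have PP' := mulmx1C PP.
pose w p (A : 'M[C]_(h, p)) i := \sum_j normc2 ((P *m A) i j).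
have w0 (A : 'M_(h, n)) i : 0 <= w _ A i.
  by apply: sumr_ge0 => j _; exact: normc2_ge0.
have wn (A : 'M_(h, n)) : A^t* *m A = 1%:M -> \sum_i w _ A i = n%:R.
  move=> AA; rewrite -frob_dotE -sqr_frob (frob_isoL _ PP') sqr_frob.
  exact: frob_isometry.
have TE' : P *m T = rdiag t *m P by rewrite TE !mulmxA PP mul1mx.
have tw p (A : 'M_(h, p)) :
    \sum_i t i * w _ A i = #|B|%:R^-1 * \sum_b frob ((V b)^t* *m A) ^+ 2.
  rewrite -dotT -frob_dot_rdiag mulmxA -TE' -mulmxA frob_dot_ctrL mulmxA PP'.
  by rewrite mul1mx.
have tavg i : t i = #|B|%:R^-1 * \sum_b w _ (V b) i.
  under eq_bigr do rewrite /w -row_weight.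
  rewrite -tw (bigD1 i) //= big1 ?addr0 => [|j ji].
    by rewrite /w big_ord1 unitary_row // !mxE normc2_bool eqxx mulr1.
  by rewrite /w big_ord1 unitary_row // !mxE normc2_bool (negPf ji) mulr0.
have t1 i : t i <= 1.
  by rewrite tavg; apply: avg_le => b; exact: row_isometry_le1.
have tn : \sum_i t i = n%:R.
  under eq_bigr do rewrite tavg; rewrite -mulr_sumr exchange_big /=.
  by under eq_bigr do rewrite wn //; rewrite sumr_const -[X in _ * X]mulr_natl mulKf // gt_eqF.
have t2 : (1 - k) * n%:R <= \sum_i t i ^+ 2.
  have -> : \sum_i t i ^+ 2 = #|B|%:R^-1 * \sum_b \sum_i t i * w _ (V b) i.
    rewrite exchange_big mulr_sumr; apply: eq_bigr => i _ /=.
    by rewrite expr2 {2}tavg -mulr_sumr mulrCA.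
  by apply: (avg_ge) => b; rewrite tw; apply: (avg_ge) => b'; exact: VV.
(* All estimates below compare [t i] with the indicator of [l < t i]. *)
have [l [l1 l2 lgap]] := spectral_gap t0 tn.
set g := _^-1 in l2 lgap.
have g0 : 0 < g by rewrite invr_gt0 mulr_gt0 // ltr0n addn1.
pose I := [set i | l < t i].
have inI i : i \in I -> l + g <= t i by rewrite inE; have [|//] := lgap i; case: ltgtP.
have notinI i : i \notin I -> t i <= l by rewrite inE -leNgt.
exists #|I|, (sel_cols P I); rewrite sel_cols_proj.
have mE : #|I|%:R = \sum_i (i \in I)%:R :> R.
  by rewrite -natr_sum -sum1_card [in LHS]big_mkcond.
pose s i : R := (i \in I)%:R.
split.
- exact: sel_cols_iso.
- rewrite mE -tn -sumrB (le_trans (ler_norm_sum _ _ _)) //.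
  apply: (@le_trans _ _ (\sum_i 3 * (t i - t i ^+ 2))).
    apply: ler_sum => i _; move: (t0 i) (t1 i) (inI i) (notinI i).
    move: (t i) => x x0 x1; case: (i \in I) => [/(_ isT) xl _|_ /(_ isT) xl].
      rewrite ger0_norm ?subr_ge0 //= expr2.
      have : 0 <= (1 - x) * (3 * x - 1) by rewrite mulr_ge0 //; lra.
      by lra.
    rewrite sub0r normrN ger0_norm //= expr2.
    have : 0 <= x * (2 - 3 * x) by rewrite mulr_ge0 //; lra.
    by lra.
  rewrite -mulr_sumr sumrB tn -mulrA ler_pM2l //; lra.
- rewrite -(frob_isoL _ PP') mulmxBr !mulmxA PP mul1mx -mulmxA -[X in X - _]mul1mx.
  rewrite -mulmxBl -rdiag1 rdiagB sqr_frob frob_dotE.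
  apply: (@le_trans _ _ (\sum_i 3 * (w _ V1 i - t i * w _ V1 i))).
    apply: ler_sum => i _; under eq_bigr do rewrite rdiag_mull normc2_ofRM.
    rewrite -mulr_sumr -/(w _ V1 i); move: (w _ V1 i) (w0 V1 i) => x x0.
    have -> : 3 * (x - t i * x) = 3 * (1 - t i) * x by ring.
    apply: ler_wpM2r => //; move: (t1 i) (notinI i).
    case: (i \in I) => [x1 _|_ /(_ isT) xl]; rewrite ?subrr ?subr0 ?expr0n ?expr1n.
      by rewrite mulr_ge0 ?subr_ge0.
    by move: (t i) xl => y yl; lra.
  rewrite -mulr_sumr sumrB wn // tw -mulrA ler_pM2l //.
  by have := avg_ge _ _ VV1; lra.
- move=> u; rewrite [X in _ <= _ * frob (_ *m X - X *m _)]TE.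
  apply: cut_commutator => // [|i j]; first by rewrite mulr_ge0.
  have Kg : K * g = 1 by rewrite /g /K mulfV // gt_eqF // mulr_gt0 // ltr0n addn1.
  move: (t0 i) (t0 j) (inI i) (notinI i) (inI j) (notinI j).
  rewrite -exprMn; move: (t i) (t j) => x y x0 y0.
  case: (i \in I) => [/(_ isT) xl _|_ /(_ isT) xl];
    case: (j \in I) => [/(_ isT) yl _|_ /(_ isT) yl];
    rewrite ?subrr ?expr0n ?sqr_ge0 //=.
    have : K * g <= K * (x - y) by rewrite ler_wpM2l ?mulr_ge0 //; lra.
    by rewrite Kg subr0 expr1n => ?; rewrite -[leLHS](expr1n R 2) ler_sqr ?nnegrE //; lra.
  have : K * g <= K * (y - x) by rewrite ler_wpM2l ?mulr_ge0 //; lra.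
  by rewrite Kg sub0r sqrrN -(sqrrN (K * _)) -mulrN opprB => ?; rewrite ler_sqr ?nnegrE //; lra.
- move=> p u; rewrite -(frob_isoR (E := (sel_cols P I)^t*)); last first.
    by rewrite (trmxCK (sel_cols P I)) sel_cols_iso.
  rewrite -mulmxA sel_cols_proj [in leRHS]TE; apply: cut_bound => // i.
  move: (t0 i) (inI i); case: (i \in I) => [x0 /(_ isT) xl|x0 _].
    by rewrite /= mulr1n -exprMn ler_sqr ?nnegrE ?mulr_ge0 //; lra.
  by rewrite expr0n /= mulr_ge0 ?sqr_ge0.
Qed.

End Cut.

(** * Almost invariant sets in virtually abelian groups *)

(** Almost invariant finite sets: each [s] of the finite set [S] acts on the
  finite family [th] of group elements, up to a proportion [1 / N], as a
  permutation of the indices. *)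
Definition folner_property (G : groupType) : Prop :=
  forall (S : seq G) (N : nat),
  exists (X : finType) (th : X -> G) (p : G -> {perm X}), (0 < #|X|)%N /\
    forall s, s \in S -> (N * #|[set x | th (p s x) != (s * th x)%g]| <= #|X|)%N.

Section Folner.
Variables (G : groupType) (H : {pred G}) (d : nat).
Hypotheses (Hgrp : group_closed H) (Hab : {in H &, forall x y : G, commute x y}).
Hypothesis Hd : (left_cosets H #<= `I_d)%card.
Local Open Scope group_scope.

Lemma left_coset_eq (x y : G) :
  [set x * h | h in [set` H]]%classic = [set y * h | h in [set` H]]%classic <->
  x^-1 * y \in H.
Proof.
have H1 : 1 \in H := Hgrp.1; have HM := group_closedM Hgrp.
have HV := group_closedV Hgrp; split=> [e|xy].
  have : [set x * h | h in [set` H]]%classic y by rewrite e; exists 1; rewrite ?mulg1.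
  by move=> [h hH <-]; rewrite mulKg.
apply/seteqP; split=> _ /= [h hH <-].
  exists (y^-1 * x * h); last by rewrite -mulgA mulVKg.
  by apply: HM => //; rewrite -(invgK (y^-1 * x)) invgM invgK HV.
exists (x^-1 * y * h); last by rewrite -mulgA mulVKg.
exact: HM.
Qed.

(** [c] sends an element to the index of its left coset and [r] chooses
  representatives. *)
Lemma coset_model : exists (I : finType) (c : G -> I) (r : I -> G),
  [/\ (#|I| <= d)%N, cancel r c & forall x y, c x = c y <-> x^-1 * y \in H].
Proof.
have /pcard_leP[f] := Hd.
pose co x := [set x * h | h in [set` H]]%classic.
have coL x : left_cosets H (co x) by exists x.
have fd x : (f (co x) < d)%N by have := @funS _ _ _ _ f _ (coL x).
pose c0 x : 'I_d := Ordinal (fd x).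
have c0E x y : c0 x = c0 y <-> x^-1 * y \in H.
  rewrite -left_coset_eq; split=> [[] e|e].
    by apply: (@inj _ _ _ f) => //; apply/mem_set/coL.
  by apply: val_inj; rewrite /= /co e.
pose I := {i : 'I_d | `[< exists x, c0 x = i >]}.
have cP x : `[< exists y, c0 y = c0 x >] by apply/asboolP; exists x.
pose c x : I := exist _ (c0 x) (cP x).
have ex (i : I) : exists x, c x = i.
  by case: i => i iP; have /asboolP[x xi] := iP; exists x; apply: val_inj.
pose r i := projT1 (cid (ex i)).
exists I, c, r; split.
- by rewrite card_sig -[X in (_ <= X)%N]card_ord max_card.
- by move=> i; rewrite /r; case: cid.
- move=> x y; rewrite -c0E; split=> [/(congr1 val) //|e]; exact: val_inj.
Qed.

Lemma prod_shift (L : finType) (a : L -> G) (l : L) (z z' : L -> nat) :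
    (forall i j, commute (a i) (a j)) ->
    z' l = (z l).+1 -> (forall i, i != l -> z' i = z i) ->
  \prod_i a i ^+ z' i = a l * \prod_i a i ^+ z i.
Proof.
move=> ac zl zi; transitivity (\prod_i ((if i == l then a l else 1) * a i ^+ z i)).
  apply: eq_bigr => i _; case: eqVneq => [->|/zi ->]; last by rewrite mul1g.
  by rewrite zl expgS.
rewrite prodgM_commute; last first.
  move=> i j _ _; case: ifP => _; last exact/commute_sym/commute1.
  exact: commuteX.
by rewrite -big_mkcond /= big_pred1_eq.
Qed.

(** Boxes in H, translated to all cosets, are almost invariant.  A box consists of
  the products of powers of finitely many elements [a l] of H with exponents below
  [N]. The [a l] are the elements of H by which the given finite set [S] moves the
  coset representatives; [s \in S] permutes the cosets and adds 1, cyclically,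
  to the exponent of one [a l]. Only the wrap-around disagrees with the
  multiplication by [s], and it concerns one point in [N]. *)
Lemma folner : folner_property G.
Proof.
move=> S [|N].
  exists unit, (fun=> 1), (fun=> 1%g); split=> //; by rewrite card_unit.
have [I [c [r [_ rK cE]]]] := coset_model.
have HM := group_closedM Hgrp; have HV := group_closedV Hgrp.
pose L : finType := ('I_(size S) * I)%type.
pose el (k : 'I_(size S)) := nth 1 S k.
pose a (l : L) := (r (c (el l.1 * r l.2)))^-1 * (el l.1 * r l.2).
have aH l : a l \in H by apply/cE; rewrite rK.
pose X : finType := (I * {ffun L -> 'I_N.+1})%type.
pose th (x : X) := r x.1 * \prod_l a l ^+ x.2 l.
pose sh (k : 'I_(size S)) (x : X) : X :=
  (c (el k * r x.1), [ffun l => if l == (k, x.1) then ordS (x.2 l) else x.2 l]).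
have sh_inj k : injective (sh k).
  move=> [i z] [j w] [] /= /cE; rewrite invgM -mulgA mulKg => /cE; rewrite !rK => <-.
  move=> /ffunP zw; congr (_, _); apply/ffunP => l.
  by have := zw l; rewrite !ffunE; case: ifP => // _ /ordS_inj.
pose p s : {perm X} := if insub (index s S) is Some k then perm (@sh_inj k) else 1%g.
exists X, th, p; split.
  by apply/card_gt0P; exists (c 1, [ffun=> ord0]).
move=> s sS; have ks : (index s S < size S)%N by rewrite index_mem.
pose k := Ordinal ks; have els : el k = s by rewrite /el nth_index.
have pE x : p s x = sh k x by rewrite /p insubT permE.
pose bad := [set x : X | x.2 (k, x.1) == ord_max].
have sub : [set x | th (p s x) != s * th x] \subset bad.
  apply/fintype.subsetP => x; rewrite !inE; apply: contraNT => ngood.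
  rewrite pE /th /sh /= (prod_shift (l := (k, x.1)) (z := fun l => x.2 l)).
  - by rewrite /a /= els mulgA mulVKg !mulgA.
  - by move=> i j; apply: Hab.
  - rewrite ffunE eqxx /= modn_small // ltn_neqAle ltn_ord andbT.
    by apply: contraNneq ngood => e; apply/eqP/val_inj; case: e.
  - by move=> l ne; rewrite ffunE (negPf ne).
(* Changing the maximal coordinate of a bad point in all possible ways gives
   [N + 1] points, and points obtained in this manner are distinct. *)
apply: leq_trans (leq_mul (leqnn _) (subset_leq_card sub)) _.
pose f (vx : 'I_N.+1 * X) : X :=
  (vx.2.1, [ffun l => if l == (k, vx.2.1) then vx.1 else vx.2.2 l]).
have -> : (N.+1 * #|bad| = #|finset.setX [set: 'I_N.+1] bad|)%N.
  by rewrite cardsX cardsT card_ord.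
rewrite -(card_in_imset (f := f)) ?max_card // => -[v [i z]] [w [j y]].
rewrite !inE /= => /eqP zm /eqP ym [] e /ffunP zy; rewrite -{j}e in ym zy *.
have vw : v = w by have := zy (k, i); rewrite !ffunE eqxx.
rewrite vw; congr (_, (_, _)); apply/ffunP => l; have := zy l; rewrite !ffunE.
by case: eqP => // -> _; rewrite zm ym.
Qed.

End Folner.

(** * Dilation of an almost homomorphism *)

Section Stack.
Variable R : realType.
Local Notation C := (cplx R).
Local Notation "x %:C" := (ofR x) : ring_scope.
Variables (X : finType) (n : nat).
Local Notation h := #|{: X * 'I_n}|.
Implicit Types f g : X -> 'M[C]_n.

(** The operator from C^n to the functions on [X] with values in C^n that maps [v] to
  [x |-> f x *m v]. *)
Definition stack f : 'M[C]_(h, n) :=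
  \matrix_(i, j) f (enum_val i).1 (enum_val i).2 j.

Lemma stackB f g : stack f - stack g = stack (fun x => f x - g x).
Proof. by apply/matrixP => i j; rewrite !mxE. Qed.

Lemma stack_mulr f (A : 'M[C]_n) : stack f *m A = stack (fun x => f x *m A).
Proof. by apply/matrixP => i j; rewrite !mxE; apply: eq_bigr => k _; rewrite mxE. Qed.

Lemma eq_stack f g : f =1 g -> stack f = stack g.
Proof. by move=> fg; apply/matrixP => i j; rewrite !mxE fg. Qed.

Lemma stack_ctr_mul f g : (stack f)^t* *m stack g = \sum_x (f x)^t* *m g x.
Proof.
apply/matrixP => i j; rewrite mxE summxE.
transitivity (\sum_(y : X * 'I_n) Num.conj (f y.1 y.2 i) * g y.1 y.2 j).
  rewrite (reindex (@enum_val _ {: X * 'I_n})) /=.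
    by apply: eq_bigr => k _; rewrite !mxE.
  by exists enum_rank => y _; [exact: enum_valK | exact: enum_rankK].
rewrite -(pair_bigA _ (fun x k => Num.conj (f x k i) * g x k j)) /=.
by apply: eq_bigr => x _; rewrite mxE; apply: eq_bigr => k _; rewrite !mxE.
Qed.

Lemma frob_stack f : frob_dot (stack f) (stack f) = \sum_x frob_dot (f x) (f x).
Proof.
rewrite /frob_dot mxtrace_mulC stack_ctr_mul raddf_sum re_sum /=.
by apply: eq_bigr => x _; rewrite mxtrace_mulC.
Qed.

Definition stack_perm (s : {perm X}) (i : 'I_h) : 'I_h :=
  enum_rank ((s^-1)%g (enum_val i).1, (enum_val i).2).

Lemma stack_perm_inj s : injective (stack_perm s).
Proof.
move=> i j /enum_rank_inj [] /perm_inj e1 e2; apply: enum_val_inj.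
by move: e1 e2; case: (enum_val i) (enum_val j) => ? ? [? ?] /= -> ->.
Qed.

Definition perm_op (s : {perm X}) : 'M[C]_h := perm_mx (perm (@stack_perm_inj s)).

Lemma perm_op_stack s f : perm_op s *m stack f = stack (fun x => f ((s^-1)%g x)).
Proof.
rewrite -row_permE; apply/matrixP => i j; rewrite !mxE permE /stack_perm.
by rewrite enum_rankK.
Qed.

Lemma perm_op_unitary s : perm_op s \is unitarymx.
Proof.
apply/unitarymxP; rewrite /perm_op tr_perm_mx map_perm_mx -perm_mxM.
by rewrite mulgV perm_mx1.
Qed.

End Stack.

Lemma sum_indicator (R : pzRingType) (T : finType) (A : {set T}) :
  \sum_x (x \in A)%:R = #|A|%:R :> R.
Proof.
rewrite -sum1_card natr_sum [RHS]big_mkcond /=.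
by apply: eq_bigr => x _; case: (x \in A).
Qed.

Section Dilation.
Variable R : realType.
Local Notation C := (cplx R).
Local Notation "x %:C" := (ofR x) : ring_scope.
Variables (G : groupType) (n : nat) (U : G -> 'M[C]_n) (e : R).
Hypothesis Uu : forall g, U g \is unitarymx.
Hypothesis Uhom : forall g k, frob (U g *m U k - U (g * k)%g) <= e.
Variables (X : finType) (th : X -> G).
Hypothesis X0 : (0 < #|X|)%N.
Local Notation q := (Num.sqrt n%:R : R).

Let c : R := (Num.sqrt #|X|%:R)^-1.

(** The isometry V_g; for a representation [U] it would be the composition of
  [U g] with the embedding [v |-> (x |-> (U x)^t* *m v)]. *)
Definition dil (g : G) : 'M[C]_(_, n) :=
  stack (fun x => c%:C *: (U (g^-1 * th x)%g)^t*).

Let c0 : 0 <= c.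
Proof. by rewrite invr_ge0 sqrtr_ge0. Qed.

Let cc : c * c = #|X|%:R^-1.
Proof. by rewrite /c -invfM -expr2 sqr_sqrtr ?ler0n. Qed.

Let cX : c * c * #|X|%:R = 1.
Proof. by rewrite cc mulVf // pnatr_eq0 -lt0n. Qed.

Let e0 : 0 <= e.
Proof. by apply: le_trans (Uhom 1 1)%g; exact: frob_ge0. Qed.

Lemma dil_mul g k : (dil g)^t* *m dil k =
  (c * c)%:C *: \sum_x U (g^-1 * th x)%g *m (U (k^-1 * th x)%g)^t*.
Proof.
rewrite stack_ctr_mul scaler_sumr; apply: eq_bigr => x _.
by rewrite ctrZ trmxCK -scalemxAl -scalemxAr scalerA -rmorphM.
Qed.

Lemma dil_iso g : (dil g)^t* *m dil g = 1%:M.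
Proof.
rewrite dil_mul; under eq_bigr do rewrite (unitarymxP (Uu _)).
by rewrite sumr_const -scaler_nat scalerA -(rmorph_nat (@ofR R)) -rmorphM cX rmorph1 scale1r.
Qed.

Lemma frob_dil g : frob (dil g) = q.
Proof. by rewrite /frob (frob_isometry (dil_iso g)). Qed.

Lemma frob_avg m p (F : X -> 'M[C]_(m, p)) (a : R) :
  (forall x, frob (F x) <= a) -> frob ((c * c)%:C *: \sum_x F x) <= a.
Proof.
move=> Fa; have c20 : 0 <= c * c by exact: mulr_ge0.
rewrite frobZ // -[leRHS]mulr1 -cX mulrCA ler_wpM2l // mulr_natr -sumr_const.
by apply: le_trans (frob_sum _ _ _) _; apply: ler_sum => x _.
Qed.

Lemma dil_gram g k : frob ((dil g)^t* *m dil k - U (g^-1 * k)%g) <= e.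
Proof.
have -> : U (g^-1 * k)%g = (c * c)%:C *: \sum_(x : X) U (g^-1 * k)%g.
  by rewrite sumr_const -scaler_nat scalerA -(rmorph_nat (@ofR R)) -rmorphM cX rmorph1 scale1r.
rewrite dil_mul -scalerBr -sumrB; apply: frob_avg => x.
have Ux := unitarymxP (Uu (k^-1 * th x)%g).
rewrite -(frob_isoR _ Ux) mulmxBl -[_ *m _ *m _]mulmxA (mulmx1C Ux) mulmx1 frobBC.
by rewrite [in leLHS](_ : (g^-1 * th x = g^-1 * k * (k^-1 * th x))%g) // mulgA mulgK.
Qed.

Lemma frob_stack_le f (a : R) : 0 <= a -> (forall x, frob (f x) <= a) ->
  frob (stack (fun x : X => c%:C *: (f x : 'M[C]_n))) <= a.
Proof.
move=> a0 fa; rewrite frob_le // frob_stack -[leRHS]mulr1 -cX mulrCA.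
rewrite mulr_natr -sumr_const mulr_sumr; apply: ler_sum => x _.
rewrite frob_dotZl frob_dotZr mulrA ler_wpM2l ?mulr_ge0 //.
by rewrite -frob_le.
Qed.

Lemma dil_intertwine g k : frob (dil (g * k)%g - dil g *m U k) <= e.
Proof.
rewrite stack_mulr stackB.
rewrite (@eq_stack _ _ _ _ (fun x => c%:C *: ((U ((g * k)^-1 * th x)%g)^t* -
   (U (g^-1 * th x)%g)^t* *m U k))); last by move=> x; rewrite -scalemxAl scalerBr.
apply: frob_stack_le => // x; rewrite -frob_ctr ctrB trmxCK ctrM trmxCK.
have Uk := unitarymxP (Uu k).
rewrite -(frob_isoL _ (mulmx1C Uk)) mulmxBr mulmxA Uk mul1mx.
by rewrite [X in _ - U X](_ : _ = k * ((g * k)^-1 * th x))%g // invgM -mulgA mulVKg.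
Qed.

Variable p : G -> {perm X}.
Variables (S : seq G) (M : nat).
Hypothesis M0 : (0 < M)%N.
Hypothesis pS : forall s, s \in S ->
  (M ^ 2 * #|[set x | th (p s x) != (s * th x)%g]| <= #|X|)%N.
Local Notation u s := (perm_op R n (p s)).
Local Notation eta := (2 * q / M%:R).

Let MR : (0 : R) < M%:R.
Proof. by rewrite ltr0n. Qed.

Let q0 : 0 <= q := sqrtr_ge0 _.

Let eta0 : 0 <= eta.
Proof. by rewrite divr_ge0 ?ler0n // mulr_ge0. Qed.

Let M2 : (M%:R ^+ 2)^-1 <= M%:R^-1 :> R.
Proof.
by rewrite lef_pV2 ?posrE ?exprn_gt0 // -natrX ler_nat -{1}(expn1 M) leq_pexp2l.
Qed.

Lemma dil_bad s : s \in S ->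
  c * c * #|[set x | th (p s x) != (s * th x)%g]|%:R <= (M%:R ^+ 2)^-1.
Proof.
move=> sS; rewrite cc mulrC ler_pdivrMr ?ltr0n // mulrC ler_pdivlMr ?exprn_gt0 //.
by rewrite -natrX -natrM ler_nat mulnC pS.
Qed.

(** The two functions agree at [x] unless the permutation fails to act as [s] at
  the preimage of [x]; there they differ by at most twice the norm of a unitary. *)
Lemma dil_shift s g : s \in S -> frob (u s *m dil g - dil (s * g)%g) <= eta.
Proof.
move=> sS; rewrite perm_op_stack stackB.
pose D x := (U (g^-1 * th ((p s)^-1%g x))%g)^t* - (U ((s * g)^-1 * th x)%g)^t*.
rewrite (@eq_stack _ _ _ _ (fun x => c%:C *: D x)); last by move=> x; rewrite scalerBr.
rewrite frob_le; last exact: eta0.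
rewrite frob_stack.
pose bad := [set x | th (p s x) != (s * th x)%g].
have DE x : frob_dot (c%:C *: D x) (c%:C *: D x) <=
    (c * c) * (4 * n%:R * ((p s)^-1%g x \in bad)%:R).
  rewrite frob_dotZl frob_dotZr mulrA ler_wpM2l ?mulr_ge0 //.
  rewrite inE; case: eqVneq => [|_] /=.
    rewrite permKV => e1; rewrite /D e1 invgM -mulgA mulKg subrr mulr0.
    by rewrite -sqr_frob frob0 expr0n.
  have fU k : frob ((U k)^t*) = q.
    by rewrite frob_ctr /frob -sqr_frob frob_unitary.
  have := frobB ((U (g^-1 * th ((p s)^-1%g x))%g)^t*) ((U ((s * g)^-1 * th x)%g)^t*).
  rewrite !fU -/(D x) => le; rewrite mulr1 -sqr_frob.
  have -> : 4 * n%:R = (q + q) ^+ 2 :> R.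
    by rewrite -[n%:R in LHS]sqr_sqrtr ?ler0n //; move: q => y; ring.
  by rewrite ler_sqr ?nnegrE ?frob_ge0 ?addr_ge0.
apply: le_trans (ler_sum (index_enum X) (fun x _ => DE x)) _.
rewrite -mulr_sumr -mulr_sumr.
have -> : \sum_x ((p s)^-1%g x \in bad)%:R = #|bad|%:R :> R.
  rewrite (reindex_perm (p s)) /= -sum_indicator.
  by apply: eq_bigr => x _; rewrite permK.
rewrite mulrCA [leRHS](_ : _ = 4 * n%:R * (M%:R ^+ 2)^-1).
  by rewrite ler_wpM2l ?mulr_ge0 ?ler0n ?dil_bad.
by rewrite -[in RHS](@sqr_sqrtr _ n%:R) ?ler0n // -exprVn; ring.
Qed.

(** Nearly a projection of rank [n], to be cut at a spectral gap. *)
Definition dilT : 'M[C]_#|{: X * 'I_n}| :=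
  (#|X|%:R^-1)%:C *: \sum_x dil (th x) *m (dil (th x))^t*.

Lemma frob_isoVV h m (A B : 'M[C]_(h, m)) : A^t* *m A = 1%:M -> B^t* *m B = 1%:M ->
  frob (A *m A^t* - B *m B^t*) <= 2 * frob (A - B).
Proof.
move=> AA BB; rewrite mulr_natl mulr2n.
apply: le_trans (frob_trans (A *m B^t*) _ _) _; apply: lerD.
  by rewrite -mulmxBr -ctrB (frob_isoL _ AA) frob_ctr.
by rewrite -mulmxBl frob_isoR // trmxCK.
Qed.

(** Conjugation by [u s] nearly permutes the summands of [dilT]. *)
Lemma dilT_commutator s : s \in S ->
  frob (u s *m dilT - dilT *m u s) <= 8 * q / M%:R.
Proof.
move=> sS; have us := perm_op_unitary R n (p s).
have usu := unitarymxP us.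
have us'u := mulmx1C usu.
pose A x := u s *m dil (th x); pose B x := dil (th (p s x)).
have AA x : (A x)^t* *m A x = 1%:M.
  by rewrite /A ctrM mulmxA -(mulmxA _ _ (u s)) us'u mulmx1 dil_iso.
have BB x : (B x)^t* *m B x = 1%:M by exact: dil_iso.
rewrite -[leLHS](frob_isoR (E := (u s)^t*)); last by rewrite trmxCK.
have c1 : u s *m dilT *m (u s)^t* = (c * c)%:C *: \sum_x A x *m (A x)^t*.
  rewrite /dilT -cc -scalemxAr -scalemxAl mulmx_sumr mulmx_suml.
  under eq_bigr => x _ do rewrite -(mulmxA (u s)) -(mulmxA (dil _)) -ctrM mulmxA.
  by [].
have c2 : dilT = (c * c)%:C *: \sum_x B x *m (B x)^t*.
  have eB : \sum_x dil (th x) *m (dil (th x))^t* = \sum_x B x *m (B x)^t*.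
    exact: (reindex_inj (@perm_inj _ (p s))).
  by rewrite cc -eB.
rewrite mulmxBl c1 -[dilT *m _ *m _]mulmxA usu mulmx1 c2 -scalerBr -sumrB.
have c20 : 0 <= c * c by exact: mulr_ge0.
pose bad := [set x | th (p s x) != (s * th x)%g].
have le x : frob (A x *m (A x)^t* - B x *m (B x)^t*) <=
    2 * eta + 4 * q * (x \in bad)%:R.
  apply: le_trans (frob_isoVV (AA x) (BB x)) _.
  have sh := dil_shift (th x) sS.
  rewrite inE; case: eqVneq => [e1|_] /=; last first.
    have := frobB (A x) (B x).
    have -> : frob (A x) = q by rewrite /frob (frob_isometry (AA x)).
    have -> : frob (B x) = q by rewrite /frob (frob_isometry (BB x)).
    have := eta0.
    by move: (frob _) (eta) (q) => *; lra.
  rewrite mulr0 addr0; apply: ler_wpM2l; first exact: ler0n.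
  by rewrite /B e1; exact: sh.
rewrite frobZ; last exact: c20.
apply: le_trans (ler_wpM2l c20 (frob_sum _ _ _)) _.
apply: le_trans (ler_wpM2l c20 (ler_sum (index_enum X) (fun x _ => le x))) _.
rewrite big_split /= sumr_const -mulr_sumr.
rewrite sum_indicator.
rewrite mulrDr -[_ *+ #|X|]mulr_natr [c * c * (_ * #|X|%:R)]mulrCA cX mulr1.
rewrite [c * c * (_ * _)]mulrCA.
have : c * c * #|bad|%:R <= M%:R^-1 := le_trans (dil_bad sS) M2.
move=> /(ler_wpM2l (mulr_ge0 (ler0n R 4) q0)).
by move: (c * c * _) (M%:R^-1) (q) => x y z; lra.
Qed.

(** The operators [u s] need not be multiplicative on all functions on [X], but they
  nearly are on the ranges of the isometries [dil g]. *)
Lemma dilT_mul s t : s \in S -> t \in S -> (s * t)%g \in S ->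
  frob ((u s *m u t - u (s * t)%g) *m dilT) <= 6 * q / M%:R.
Proof.
move=> sS tS stS.
rewrite /dilT -cc -scalemxAr mulmx_sumr; apply: frob_avg => x.
have dd := dil_iso (th x); rewrite mulmxA frob_isoR ?trmxCK //.
pose g := th x; rewrite -/g mulmxBl -mulmxA.
have us r := mulmx1C (unitarymxP (perm_op_unitary R n (p r))).
apply: le_trans (frob_trans (u s *m dil (t * g)%g) _ _) _.
rewrite -mulmxBr (frob_isoL _ (us s)).
have h1 := dil_shift g tS.
have h3 := dil_shift (t * g)%g sS.
have h4 := dil_shift g stS; rewrite frobBC -mulgA in h4.
have -> : 6 * q / M%:R = eta + (eta + eta) by clear; ring.
apply: lerD h1 _; apply: le_trans (frob_trans (dil (s * (t * g))%g) _ _) _.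
exact: lerD h3 h4.
Qed.

End Dilation.

(** * Approximate representations *)

Section Approx.
Variable R : realType.
Local Notation C := (cplx R).

(** What a finite-dimensional compression retains of a representation [pi] of G
  on [C^m] and an almost intertwiner [W] from the map [U], up to an error
  [del] and for the elements of [S] only. *)
Record approx_rep (G : groupType) n (U : G -> 'M[C]_n) (eps : R) (S : seq G)
    (del : R) m (pi : G -> 'M[C]_m) (W : 'M[C]_(m, n)) : Prop := ApproxRep {
  approx_dim : `|m%:R - n%:R| <= 6 * eps * n%:R;
  approx_bound : forall g, frob (pi g) ^+ 2 <= m%:R;
  approx_unitary : forall s, s \in S -> frob (pi s *m (pi s)^t* - 1%:M) <= del;
  approx_mul : forall s t, s \in S -> t \in S ->
    frob (pi s *m pi t - pi (s * t)%g) <= del;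
  approx_intertwine : forall s, s \in S -> frob (pi s *m W - W *m U s) <=
    (Num.sqrt (6 * eps) + eps) * Num.sqrt n%:R + del;
  approx_norm : (1 - 6 * eps) * n%:R <= frob W ^+ 2;
  approx_contrL : forall p (A : 'M_(n, p)), frob (W *m A) <= frob A;
  approx_contrR : forall p (A : 'M_(m, p)), frob (W^t* *m A) <= frob A }.

Lemma frob_mul_iso_le h m p (E : 'M[C]_(h, m)) (A : 'M[C]_(p, h)) :
  E^t* *m E = 1%:M -> frob (A *m E) <= frob A.
Proof.
move=> EE; rewrite -frob_ctr ctrM -[leRHS]frob_ctr.
exact: frob_coiso_le.
Qed.

(** The compression to the range of [E] is multiplicative up to the commutator
  with the projection [E *m E^t*] and the defect of multiplicativity on [E]. *)
Lemma compress_mul h m (E : 'M[C]_(h, m)) (a b d : 'M[C]_h) : E^t* *m E = 1%:M ->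
  E^t* *m a *m E *m (E^t* *m b *m E) - E^t* *m d *m E =
  E^t* *m ((a *m (E *m E^t*) - E *m E^t* *m a) *m b *m E)
  + E^t* *m ((a *m b - d) *m E).
Proof.
move=> EE; rewrite mulmxBl mulmxBl mulmxBr [(a *m b - d) *m E]mulmxBl mulmxBr.
rewrite -!mulmxA (mulmxA (E^t*) E) EE mul1mx.
by rewrite addrA subrK.
Qed.

(** [V1 = dil U th 1] is nearly contained in the range of [E], whence
  [W = E^t* *m V1] is nearly isometric, and [W *m U s], [E^t* *m dil U th s] and
  [E^t* *m u s *m E *m W] are close to each other. *)
Lemma approx_rep_exists (G : groupType) n (U : G -> 'M[C]_n) (eps : R) :
    folner_property G -> 0 <= eps ->
    (forall g, U g \is unitarymx) ->
    (forall g k, frob (U g *m U k - U (g * k)%g) <= eps * Num.sqrt n%:R) ->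
  forall (S : seq G) (del : R), 0 < del ->
  exists m (pi : G -> 'M[C]_m) (W : 'M[C]_(m, n)), approx_rep U eps S del pi W.
Proof.
move=> fol eps0 Uu Uhom S del del0.
pose q := Num.sqrt n%:R : R; have q0 : 0 <= q := sqrtr_ge0 _.
have qq : q ^+ 2 = n%:R by rewrite sqr_sqrtr ?ler0n.
pose K : R := 3 * (3 * n + 1)%N%:R; have K0 : 0 <= K by rewrite mulr_ge0 ?ler0n.
(* The families are invariant up to [1 / M ^ 2], because the norms see the square
   root of the proportion of bad points. *)
have [M M0 Mdel] : exists2 M, (0 < M)%N & (8 * K + 18) * q / M%:R <= del.
  pose b := (8 * K + 18) * q / del.
  have b0 : 0 <= b.
    by apply: divr_ge0 (ltW del0); apply: mulr_ge0 => //; apply: addr_ge0; rewrite ?mulr_ge0.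
  have [M bM] : exists M : nat, b < M%:R.
    by exists (Num.bound b); exact: archi_boundP.
  have M0 : (0 : R) < M%:R := le_lt_trans b0 bM.
  exists M; first by rewrite -(ltr0n R).
  by rewrite ler_pdivrMr // [leRHS]mulrC -ler_pdivrMr // ltW.
(* Multiplicativity on [S] involves the permutations of the products. *)
pose S' := S ++ [seq (x * y)%g | x <- S, y <- S].
have [X [th [p [X0 pS']]]] := fol S' (M ^ 2)%N.
have SS' s : s \in S -> s \in S' by rewrite mem_cat => ->.
have SSS' s t : s \in S -> t \in S -> (s * t)%g \in S'.
  by move=> sS tS; rewrite mem_cat (allpairs_f _ sS tS) orbT.
have gram g k : (1 - 2 * eps) * n%:R <= frob ((dil U th g)^t* *m dil U th k) ^+ 2.
  have := dil_gram Uu Uhom th X0 g k; rewrite -/q.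
  have := frobB ((dil U th g)^t* *m dil U th k)
    ((dil U th g)^t* *m dil U th k - U (g^-1 * k)%g).
  rewrite opprB addrC subrK.
  have -> : frob (U (g^-1 * k)%g) = q by rewrite /frob -sqr_frob frob_unitary.
  rewrite -qq; move: (frob_ge0 ((dil U th g)^t* *m dil U th k)).
  move: (frob _) (frob _) q0 eps0; clear=> y x; move: q => r r0 eps0 x0 h1 h2.
  (* For [2 * eps >= 1] the bound is trivial. *)
  have [|le1] := leP 1 (2 * eps); first by have := sqr_ge0 x; have := sqr_ge0 r; nra.
  have h : (1 - eps) * r <= x by lra.
  have : ((1 - eps) * r) ^+ 2 <= x ^+ 2.
    by rewrite ler_sqr ?nnegrE // mulr_ge0 //; lra.
  have := sqr_ge0 (eps * r); lra.
have [m [E [EE Em E1 Ecomm Ebd]]] := spectral_cut X0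
  (fun x => dil_iso Uu th X0 (th x)) (dil_iso Uu th X0 1%g)
  (fun x y => gram (th x) (th y)) (fun x => gram (th x) 1%g).
rewrite -/(dilT U th) -/K in Ecomm Ebd.
set V1 := dil U th 1%g in E1.
pose u s := perm_op R n (p s); pose P := E *m E^t*.
have uu s := unitarymxP (perm_op_unitary R n (p s)).
have uu' s : (u s)^t* *m u s = 1%:M := mulmx1C (uu s).
have d1 : 8 * q / M%:R * K + 18 * q / M%:R <= del.
  by apply: le_trans Mdel; rewrite le_eqVlt; apply/orP; left; apply/eqP; ring.
have d18 : 0 <= 18 * q / M%:R by rewrite divr_ge0 ?ler0n // mulr_ge0.
have d2 : 8 * q / M%:R * K <= del by apply: le_trans d1; rewrite lerDl.
have comm s : s \in S' -> frob (u s *m P - P *m u s) <= K * (8 * q / M%:R).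
  move=> sS; apply: le_trans (Ecomm _) _; apply: ler_wpM2l => //.
  exact: (dilT_commutator Uu X0 M0 pS' sS).
have cut_mul s t : s \in S -> t \in S ->
    frob ((u s *m u t - u (s * t)%g) *m E) <= 3 * (6 * q / M%:R).
  move=> sS tS; apply: le_trans (Ebd _ _) _; apply: ler_wpM2l; first exact: ler0n.
  exact: (dilT_mul Uu X0 M0 pS' (SS' _ sS) (SS' _ tS) (SSS' _ _ sS tS)).
have PE : P *m E = E by rewrite /P -mulmxA EE mulmx1.
have EP : E^t* *m P = E^t* by rewrite /P mulmxA EE mul1mx.
exists m, (fun g => E^t* *m u g *m E), (E^t* *m V1).
split.
- by apply: le_trans Em _; rewrite [3 * _]mulrA -[3 * 2]natrM.
- move=> g /=; rewrite -(frob_isometry EE) -sqr_frob.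
  rewrite ler_sqr ?nnegrE ?frob_ge0 // -mulmxA.
  by apply: le_trans (frob_coiso_le _ EE) _; rewrite (frob_isoL _ (uu' g)).
- move=> s sS /=.
  have -> : E^t* *m u s *m E *m (E^t* *m u s *m E)^t* - 1%:M =
      E^t* *m ((u s *m P - P *m u s) *m (u s)^t* *m E).
    rewrite !ctrM trmxCK !mulmxBl !mulmxBr -[_ *m u s *m (u s)^t*]mulmxA uu.
    by rewrite mulmx1 PE EE /P !mulmxA.
  apply: le_trans (frob_coiso_le _ EE) _; apply: le_trans (frob_mul_iso_le _ EE) _.
  rewrite frob_isoR; last by rewrite trmxCK uu'.
  by apply: le_trans (comm s (SS' s sS)) _; rewrite mulrC; exact: d2.
- move=> s t sS tS /=.
  have -> : E^t* *m u s *m E *m (E^t* *m u t *m E) - E^t* *m u (s * t)%g *m E =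
      E^t* *m ((u s *m P - P *m u s) *m u t *m E) +
      E^t* *m ((u s *m u t - u (s * t)%g) *m E).
    exact: compress_mul.
  apply: le_trans (frobD _ _) _; apply: le_trans d1; apply: lerD.
    apply: le_trans (frob_coiso_le _ EE) _; apply: le_trans (frob_mul_iso_le _ EE) _.
    by rewrite frob_isoR ?uu //; rewrite mulrC; apply: comm; exact: SS'.
  apply: le_trans (frob_coiso_le _ EE) _; apply: le_trans (cut_mul s t sS tS) _.
  by rewrite le_eqVlt; apply/orP; left; apply/eqP; clear; ring.
- move=> s sS /=.
  have -> : E^t* *m u s *m E *m (E^t* *m V1) - E^t* *m V1 *m U s =
      E^t* *m (u s *m (P *m V1 - V1)) + E^t* *m (u s *m V1 - dil U th (s * 1)%g)
      + E^t* *m (dil U th (s * 1)%g - dil U th 1%g *m U s).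
    by rewrite -/V1 !mulmxBr /P !mulmxA !subrKA.
  have b1 : frob (E^t* *m (u s *m (P *m V1 - V1))) <= Num.sqrt (6 * eps) * q.
    apply: le_trans (frob_coiso_le _ EE) _; rewrite (frob_isoL _ (uu' s)) frobBC.
    have s0 : 0 <= Num.sqrt (6 * eps) * q by rewrite mulr_ge0 ?sqrtr_ge0.
    rewrite -(ler_sqr (frob_ge0 _) s0) exprMn qq.
    rewrite (@sqr_sqrtr _ (6 * eps)); last by rewrite mulr_ge0 ?ler0n.
    by apply: le_trans E1 _; rewrite mulrA -natrM.
  have b2 : frob (E^t* *m (u s *m V1 - dil U th (s * 1)%g)) <= del.
    apply: le_trans (frob_coiso_le _ EE) _.
    have sh := dil_shift Uu X0 M0 pS' 1%g (SS' _ sS).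
    apply: le_trans sh _; rewrite -/q.
    have : 0 <= 8 * q / M%:R * K by rewrite mulr_ge0 ?divr_ge0 ?ler0n ?mulr_ge0.
    by move: d1 d18; clear; lra.
  have b3 : frob (E^t* *m (dil U th (s * 1)%g - dil U th 1%g *m U s)) <= eps * q.
    apply: le_trans (frob_coiso_le _ EE) _; rewrite mulg1 -{1}(mul1g s).
    exact: dil_intertwine.
  have -> : (Num.sqrt (6 * eps) + eps) * Num.sqrt n%:R + del =
      Num.sqrt (6 * eps) * q + del + eps * q by rewrite mulrDl -/q addrAC.
  apply: le_trans (frobD _ _) _; apply: lerD b3.
  by apply: le_trans (frobD _ _) _; exact: lerD b1 b2.
- have := frob_pythagoras V1 EE.
  rewrite -(sqr_frob V1) -(sqr_frob (_^t* *m _)) -(sqr_frob (_ - _)).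
  rewrite (frob_dil Uu th X0) -/q qq.
  have -> : (1 - 6 * eps) * n%:R = n%:R - 3 * (2 * eps) * n%:R :> R by clear; ring.
  by move: E1; move: (frob _ ^+ 2) (frob _ ^+ 2); clear=> x y; lra.
- move=> r A; rewrite -mulmxA.
  apply: le_trans (frob_coiso_le _ EE) _.
  by rewrite (frob_isoL _ (dil_iso Uu th X0 1%g)).
- move=> r A; rewrite ctrM trmxCK -mulmxA.
  apply: le_trans (frob_coiso_le _ (dil_iso Uu th X0 1%g)) _.
  by rewrite (frob_isoL _ EE).
Qed.
End Approx.

(** * Limits along an ultrafilter *)

Section UltraLimit.
Import numFieldNormedType.Exports.
Variable R : realType.
Local Open Scope classical_set_scope.

Definition bounded_seq (f : nat -> R) : Prop := exists M : R, forall k, `|f k| <= M.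

(** The limit along a free ultrafilter on the natural numbers. *)
Lemma ultralimit : exists L : (nat -> R) -> R,
  [/\ forall a, L (fun=> a) = a,
      forall f g, bounded_seq f -> bounded_seq g ->
        L (fun k => f k + g k) = L f + L g,
      forall f g, bounded_seq f -> bounded_seq g ->
        L (fun k => f k * g k) = L f * L g &
      forall f a N, bounded_seq f -> (forall k, (N <= k)%N -> f k <= a) -> L f <= a].
Proof.
have [F [FU sF]] := @ultraFilterLemma _ \oo _.
have FF : ProperFilter F := ultra_proper.
have cv (f : nat -> R) : bounded_seq f -> exists l : R, f @ F --> l.
  move=> [M fM].
  have FI : F (f @^-1` `[- M, M]).
    by apply: filterE => k; rewrite /= in_itv /= -ler_norml.
  have [l [_ cl]] := @segment_compact R (- M) M (f @ F) _ FI.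
  exists l => V lV; have [//|FV] := in_ultra_setVsetC (f @^-1` V) FU.
  by have [x [nVx Vx]] := cl (~` V) V FV lV.
pose L f := lim (f @ F : set_system R).
have LE (f : nat -> R) (l : R) : f @ F --> l -> L f = l by exact: cvg_lim.
exists L; split.
- by move=> a; apply: LE; exact: cvg_cst.
- move=> f g /cv[a fa] /cv[b gb]; rewrite (LE _ _ fa) (LE _ _ gb).
  by apply: LE; exact: cvgD.
- move=> f g /cv[a fa] /cv[b gb]; rewrite (LE _ _ fa) (LE _ _ gb).
  by apply: LE; exact: cvgM.
- move=> f a N /cv[l fl] fa; rewrite (LE _ _ fl).
  have near_fa : \forall k \near F, f k <= a by apply: sF; exists N.
  exact: (ler_cvg_to fl (cvg_cst a) near_fa).
Qed.

End UltraLimit.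

Section BoundedSequences.
Variable R : realType.
Implicit Types f g : nat -> R.

Lemma bounded_cst (a : R) : bounded_seq (fun=> a).
Proof. by exists `|a|. Qed.

Lemma bounded_add f g : bounded_seq f -> bounded_seq g ->
  bounded_seq (fun k => f k + g k).
Proof.
move=> [a fa] [b gb]; exists (a + b) => k.
by apply: le_trans (ler_normD _ _) _; exact: lerD.
Qed.

Lemma bounded_mul f g : bounded_seq f -> bounded_seq g ->
  bounded_seq (fun k => f k * g k).
Proof.
move=> [a fa] [b gb]; exists (a * b) => k.
by rewrite normrM; apply: ler_pM.
Qed.

Lemma bounded_opp f : bounded_seq f -> bounded_seq (fun k => - f k).
Proof. by move=> [a fa]; exists a => k; rewrite normrN. Qed.

End BoundedSequences.

Section MatrixLimit.
Variable R : realType.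
Local Notation C := (cplx R).
Variable L : (nat -> R) -> R.
Hypothesis Lcst : forall a, L (fun=> a) = a.
Hypothesis LD : forall f g, bounded_seq f -> bounded_seq g ->
  L (fun k => f k + g k) = L f + L g.
Hypothesis LM : forall f g, bounded_seq f -> bounded_seq g ->
  L (fun k => f k * g k) = L f * L g.
Hypothesis Lle : forall f a N, bounded_seq f ->
  (forall k, (N <= k)%N -> f k <= a) -> L f <= a.

Let LN f : bounded_seq f -> L (fun k => - f k) = - L f.
Proof.
move=> bf; apply: (addrI (L f)); rewrite subrr -LD //; last exact: bounded_opp.
by rewrite -[RHS](Lcst 0); congr L; apply: funext => k; rewrite subrr.
Qed.

Definition cbounded (f : nat -> C) :=
  bounded_seq (fun k => re (f k)) /\ bounded_seq (fun k => im (f k)).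

(** The ultralimit of a bounded complex sequence. On matrices, [mlim] is therefore
  compatible with products and adjoints, and with the Frobenius norm. *)
Definition clim (f : nat -> C) : C :=
  mkC (L (fun k => re (f k))) (L (fun k => im (f k))).

Lemma cbounded_add f g : cbounded f -> cbounded g -> cbounded (fun k => f k + g k).
Proof.
move=> [f1 f2] [g1 g2]; split.
  by under eq_fun do rewrite reD; exact: bounded_add.
by under eq_fun do rewrite imD; exact: bounded_add.
Qed.

Lemma cbounded_mul f g : cbounded f -> cbounded g -> cbounded (fun k => f k * g k).
Proof.
move=> [f1 f2] [g1 g2]; split.
  under eq_fun do rewrite reM; apply: bounded_add; first exact: bounded_mul.
  by apply: bounded_opp; exact: bounded_mul.
by under eq_fun do rewrite imM; apply: bounded_add; exact: bounded_mul.
Qed.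

Lemma cbounded_cst (a : C) : cbounded (fun=> a).
Proof. by split; exact: bounded_cst. Qed.

Lemma cbounded_conj f : cbounded f -> cbounded (fun k => Num.conj (f k)).
Proof.
move=> [f1 f2]; split; first by under eq_fun do rewrite re_conj.
by under eq_fun do rewrite im_conj; exact: bounded_opp.
Qed.

Lemma clim_cst a : clim (fun=> a) = a.
Proof. by apply: cplx_eq; rewrite ?re_mkC ?im_mkC Lcst. Qed.

Lemma clim_add f g : cbounded f -> cbounded g ->
  clim (fun k => f k + g k) = clim f + clim g.
Proof.
move=> [f1 f2] [g1 g2]; apply: cplx_eq; rewrite ?reD ?imD ?re_mkC ?im_mkC -LD //.
  by congr L; apply: funext => k; rewrite reD.
by congr L; apply: funext => k; rewrite imD.
Qed.

Lemma clim_mul f g : cbounded f -> cbounded g ->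
  clim (fun k => f k * g k) = clim f * clim g.
Proof.
move=> [f1 f2] [g1 g2]; apply: cplx_eq; rewrite ?reM ?imM !(re_mkC, im_mkC).
  rewrite -!LM // -LN; last exact: bounded_mul.
  rewrite -LD; [|exact: bounded_mul|by apply: bounded_opp; exact: bounded_mul].
  by congr L; apply: funext => k; rewrite reM.
rewrite -!LM // -LD; [|exact: bounded_mul|exact: bounded_mul].
by congr L; apply: funext => k; rewrite imM.
Qed.

Lemma clim_conj f : cbounded f -> clim (fun k => Num.conj (f k)) = Num.conj (clim f).
Proof.
move=> [f1 f2]; apply: cplx_eq; rewrite ?re_conj ?im_conj !(re_mkC, im_mkC).
  by congr L; apply: funext => k; rewrite re_conj.
by rewrite -LN //; congr L; apply: funext => k; rewrite im_conj.
Qed.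

Lemma cbounded_sum (I : Type) (r : seq I) (F : nat -> I -> C) :
  (forall i, cbounded (fun k => F k i)) ->
  cbounded (fun k => \sum_(i <- r) F k i).
Proof.
move=> bF; elim: r => [|i r IH]; under eq_fun do rewrite ?big_nil ?big_cons.
  exact: cbounded_cst.
exact: cbounded_add.
Qed.

Lemma clim_sum (I : Type) (r : seq I) (F : nat -> I -> C) :
  (forall i, cbounded (fun k => F k i)) ->
  clim (fun k => \sum_(i <- r) F k i) = \sum_(i <- r) clim (fun k => F k i).
Proof.
move=> bF; elim: r => [|i r IH].
  by rewrite big_nil; under eq_fun do rewrite big_nil; exact: clim_cst.
rewrite big_cons; under eq_fun do rewrite big_cons.
by rewrite -IH clim_add //; exact: cbounded_sum.
Qed.

Definition mbounded m n (A : nat -> 'M[C]_(m, n)) :=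
  forall i j, cbounded (fun k => A k i j).

Definition mlim m n (A : nat -> 'M[C]_(m, n)) : 'M[C]_(m, n) :=
  \matrix_(i, j) clim (fun k => A k i j).

Lemma mbounded_mul m n p (A : nat -> 'M[C]_(m, n)) (B : nat -> 'M[C]_(n, p)) :
  mbounded A -> mbounded B -> mbounded (fun k => A k *m B k).
Proof.
move=> bA bB i j; under eq_fun do rewrite mxE.
by apply: cbounded_sum => l; exact: cbounded_mul.
Qed.

Lemma mlim_mul m n p (A : nat -> 'M[C]_(m, n)) (B : nat -> 'M[C]_(n, p)) :
  mbounded A -> mbounded B -> mlim (fun k => A k *m B k) = mlim A *m mlim B.
Proof.
move=> bA bB; apply/matrixP => i j; rewrite !mxE; under eq_fun do rewrite mxE.
rewrite clim_sum; last by move=> l; exact: cbounded_mul.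
by apply: eq_bigr => l _; rewrite !mxE clim_mul.
Qed.

Lemma mbounded_ctr m n (A : nat -> 'M[C]_(m, n)) :
  mbounded A -> mbounded (fun k => (A k)^t*).
Proof. by move=> bA i j; under eq_fun do rewrite !mxE; exact: cbounded_conj. Qed.

Lemma mlim_ctr m n (A : nat -> 'M[C]_(m, n)) :
  mbounded A -> mlim (fun k => (A k)^t*) = (mlim A)^t*.
Proof.
move=> bA; apply/matrixP => i j; rewrite !mxE; under eq_fun do rewrite !mxE.
exact: clim_conj.
Qed.

Lemma mbounded_cst m n (A : 'M[C]_(m, n)) : mbounded (fun=> A).
Proof. by move=> i j; exact: cbounded_cst. Qed.

Lemma mlim_cst m n (A : 'M[C]_(m, n)) : mlim (fun=> A) = A.
Proof. by apply/matrixP => i j; rewrite mxE clim_cst. Qed.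

Lemma mbounded_sub m n (A B : nat -> 'M[C]_(m, n)) :
  mbounded A -> mbounded B -> mbounded (fun k => A k - B k).
Proof.
move=> bA bB i j; under eq_fun do rewrite !mxE -mulN1r.
apply: cbounded_add => //; apply: cbounded_mul => //; exact: cbounded_cst.
Qed.

Lemma mlim_sub m n (A B : nat -> 'M[C]_(m, n)) :
  mbounded A -> mbounded B -> mlim (fun k => A k - B k) = mlim A - mlim B.
Proof.
move=> bA bB; apply/matrixP => i j; rewrite !mxE.
under eq_fun do rewrite !mxE -mulN1r.
have cN1 := cbounded_cst (-1 : C).
by rewrite clim_add // ?clim_mul // ?clim_cst ?mulN1r //; exact: cbounded_mul.
Qed.

Lemma mlim_frob m n (A : nat -> 'M[C]_(m, n)) : mbounded A ->
  bounded_seq (fun k => frob_dot (A k) (A k)) /\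
  frob_dot (mlim A) (mlim A) = L (fun k => frob_dot (A k) (A k)).
Proof.
move=> bA; have bA' := mbounded_ctr bA; have bAA := mbounded_mul bA bA'.
have b1 := cbounded_sum (index_enum 'I_m) (fun i => bAA i i).
have e1 := clim_sum (index_enum 'I_m) (fun i => bAA i i).
split; first exact: b1.1.
rewrite {1}/frob_dot -mlim_ctr // -mlim_mul // /mxtrace.
by under eq_bigr do rewrite mxE; rewrite -e1 re_mkC.
Qed.

Lemma mlim_frob_le m n (A : nat -> 'M[C]_(m, n)) (c : R) : mbounded A -> 0 <= c ->
    (forall del, 0 < del -> exists N, forall k, (N <= k)%N -> frob (A k) <= c + del) ->
  frob (mlim A) <= c.
Proof.
move=> bA c0 lim; have [b e] := mlim_frob bA.
apply/ler_addgt0Pr => del del0; have [N AN] := lim _ del0.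
have cd : 0 <= c + del by rewrite addr_ge0 // ltW.
rewrite frob_le // e; apply: (Lle (N := N)) => // k Nk.
by rewrite -frob_le // AN.
Qed.

Lemma mlim_frob_ge m n (A : nat -> 'M[C]_(m, n)) (c : R) : mbounded A ->
  (forall k, c <= frob (A k) ^+ 2) -> c <= frob (mlim A) ^+ 2.
Proof.
move=> bA cA; have [b e] := mlim_frob bA; rewrite sqr_frob e.
rewrite -lerN2 -LN //; apply: (Lle (N := 0)); first exact: bounded_opp.
by move=> k _; rewrite lerN2 -sqr_frob.
Qed.

Lemma frob_mbounded m n (A : nat -> 'M[C]_(m, n)) (c : R) :
  (forall k, frob (A k) ^+ 2 <= c) -> mbounded A.
Proof.
move=> Ac i j.
have le k : normc2 (A k i j) <= c.
  apply: le_trans (Ac k); rewrite sqr_frob frob_dotE (bigD1 i) //= (bigD1 j) //=.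
  rewrite -addrA lerDl addr_ge0 // ?sumr_ge0 // => *; rewrite ?normc2_ge0 //.
  by apply: sumr_ge0 => *; exact: normc2_ge0.
have sq (x y : R) : x ^+ 2 + y ^+ 2 <= c -> `|x| <= c + 1.
  move=> xy; rewrite ler_norml; have := sqr_ge0 y; have := sqr_ge0 (x - 1).
  by have := sqr_ge0 (x + 1); move=> *; apply/andP; split; nra.
split; exists (c + 1) => k; have := le k; rewrite /normc2; first exact: sq.
by rewrite addrC; exact: sq.
Qed.

End MatrixLimit.

(** * Exact representations *)

Section Limit.
Variable R : realType.
Local Notation C := (cplx R).

Lemma countable_exhaustion (T : choiceType) : countable [set: T] ->
  exists S : nat -> seq T, (forall k l, (k <= l)%N -> {subset S k <= S l}) /\
    forall x, exists k, x \in S k.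
Proof.
move=> /pcard_leP[f].
have finj : injective f by move=> x y; apply: (@inj _ _ _ f); rewrite inE.
pose inv (i : nat) := if pselect (exists x, f x = i) is left e then Some (projT1 (cid e)) else None.
have invf x : inv (f x) = Some x.
  rewrite /inv; case: pselect => [e|]; last by case; exists x.
  by congr Some; exact: finj (projT2 (cid e)).
exists (fun k => pmap inv (iota 0 k)); split=> [k l kl x|x].
  by rewrite -(subnKC kl) iotaD pmap_cat mem_cat => ->.
exists (f x).+1; rewrite mem_pmap; apply/mapP; exists (f x); last by rewrite invf.
by rewrite mem_iota add0n ltnS leqnn.
Qed.

Lemma approx_repW (G : groupType) n (U : G -> 'M[C]_n) (eps : R) (S S' : seq G)
    (del del' : R) m (pi : G -> 'M[C]_m) (W : 'M[C]_(m, n)) :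
  {subset S <= S'} -> del' <= del ->
  approx_rep U eps S' del' pi W -> approx_rep U eps S del pi W.
Proof.
move=> sS ld [h1 h2 h3 h4 h5 h6 h7 h8]; split=> //.
- by move=> s sS1; apply: le_trans ld; apply: h3; exact: sS.
- by move=> s t sS1 tS1; apply: le_trans ld; apply: h4; exact: sS.
- by move=> s sS1; apply: le_trans (h5 s (sS _ sS1)) _; rewrite lerD2l.
Qed.

(** A limit along a free ultrafilter turns approximate relations, which become
  better and hold on larger and larger finite sets, into exact ones. *)
Lemma limit_rep (G : groupType) n (U : G -> 'M[C]_n) (eps : R) :
    countable [set: G] -> 0 <= eps ->
    (forall (S : seq G) (del : R), 0 < del ->
      exists m (pi : G -> 'M[C]_m) (W : 'M[C]_(m, n)), approx_rep U eps S del pi W) ->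
  exists m (pi : G -> 'M[C]_m) (W : 'M[C]_(m, n)),
    forall S, approx_rep U eps S 0 pi W.
Proof.
move=> cG eps0 app; have [S [Smono Sall]] := countable_exhaustion cG.
pose del k : R := k.+1%:R^-1.
have del0 k : 0 < del k by rewrite invr_gt0 ltr0n.
have delmono k l : (k <= l)%N -> del l <= del k.
  by move=> kl; rewrite lef_pV2 ?posrE ?ltr0n // ler_nat.
have delsmall e : 0 < e -> exists N, forall k, (N <= k)%N -> del k <= e.
  move=> e0; exists (Num.bound e^-1) => k Nk; rewrite -[leRHS]invrK.
  rewrite lef_pV2 ?posrE ?ltr0n ?invr_gt0 //.
  have ei0 : 0 <= e^-1 by rewrite invr_ge0 ltW.
  by apply: le_trans (ltW (archi_boundP ei0)) _; rewrite ler_nat leqW.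
pose P k m := exists (pi : G -> 'M[C]_m) (W : 'M[C]_(m, n)),
  approx_rep U eps (S k) (del k) pi W.
have Pmono k l m : (k <= l)%N -> P l m -> P k m.
  move=> kl [pi [W a]]; exists pi, W.
  by apply: approx_repW a; [exact: Smono | exact: delmono].
(* The dimensions stay bounded, hence one dimension occurs at all stages. *)
have [m Pm] : exists m, forall k, P k m.
  pose b : R := n%:R + 6 * eps * n%:R; pose B := Num.bound b.
  have PB k m : P k m -> (m < B)%N.
    move=> [pi [W a]]; rewrite -(ltr_nat R); have := approx_dim a.
    have b0 : 0 <= b by rewrite addr_ge0 ?mulr_ge0 ?ler0n.
    rewrite ler_norml => /andP[_ h]; apply: le_lt_trans (archi_boundP b0).
    by rewrite /b; lra.
  apply: contrapT => nP.
  have bad m : exists k, ~ P k m.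
    by apply: contrapT => nk; apply: nP; exists m => k; apply: contrapT => ?; apply: nk; exists k.
  pose kk m := projT1 (cid (bad m)).
  have kkP m : ~ P (kk m) m by rewrite /kk; case: cid.
  pose K := (\max_(m < B) kk m)%N.
  have [m [pi [W a]]] := app (S K) (del K) (del0 K).
  have PK : P K m by exists pi, W.
  apply: (kkP m); apply: Pmono PK.
  exact: (leq_bigmax (Ordinal (PB _ _ (ex_intro _ pi (ex_intro _ W a))))).
pose pi k := projT1 (cid (Pm k)); pose W k := projT1 (cid (projT2 (cid (Pm k)))).
have A k : approx_rep U eps (S k) (del k) (pi k) (W k).
  exact: projT2 (cid (projT2 (cid (Pm k)))).
have [L [L1 L2 L3 L4]] := ultralimit R.
have bpi g : mbounded (fun k => pi k g).
  by apply: (frob_mbounded (c := m%:R)) => k; exact: approx_bound (A k) g.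
have bW : mbounded W.
  apply: (frob_mbounded (c := n%:R)) => k; rewrite -(frob_dot1 R n) -sqr_frob.
  rewrite ler_sqr ?nnegrE ?frob_ge0 //.
  by rewrite -[X in frob X <= _]mulmx1; exact: approx_contrL (A k) _ _.
have ev g : exists N, forall k, (N <= k)%N -> g \in S k.
  by have [N gN] := Sall g; exists N => k Nk; exact: Smono gN.
have evle (F : seq G) (a : nat -> R) c :
    (forall k, {subset F <= S k} -> a k <= c + del k) ->
    forall e, 0 < e -> exists N, forall k, (N <= k)%N -> a k <= c + e.
  move=> ak e /delsmall[N1 N1e].
  have [N2 N2F] : exists N, forall k, (N <= k)%N -> {subset F <= S k}.
    elim: F {ak} => [|g F [N IH]]; first by exists 0 => k _ x; rewrite in_nil.
    have [N' N'g] := ev g; exists (maxn N N') => k.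
    rewrite geq_max => /andP[k1 k2] x; rewrite inE => /predU1P[->|]; first exact: N'g.
    exact: IH.
  exists (maxn N1 N2) => k; rewrite geq_max => /andP[k1 k2].
  by apply: le_trans (ak k (N2F k k2)) _; rewrite lerD2l N1e.
have b1 l : mbounded (fun=> 1%:M : 'M[C]_l) by exact: mbounded_cst.
have bU g : mbounded (fun=> U g) by exact: mbounded_cst.
have bpi' g := mbounded_ctr (bpi g).
exists m, (fun g => mlim L (fun k => pi k g)), (mlim L W) => S0; split.
- exact: approx_dim (A 0).
- move=> g; rewrite sqr_frob (mlim_frob L1 L2 L3 (bpi g)).2.
  apply: (L4 _ _ 0%N) => [|k _]; first exact: (mlim_frob L1 L2 L3 (bpi g)).1.
  by rewrite -sqr_frob; exact: approx_bound (A k) g.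
- move=> s _; rewrite -(mlim_ctr L1 L2) // -(mlim_mul L1 L2 L3) //.
  rewrite -[X in _ - X](mlim_cst L1) -(mlim_sub L1 L2 L3) //; last exact: mbounded_mul.
  apply: (mlim_frob_le L1 L2 L3 L4) => //.
    by apply: mbounded_sub => //; exact: mbounded_mul.
  apply: (evle [:: s]) => k sk; rewrite add0r; apply: (approx_unitary (A k)).
  by apply: sk; rewrite inE.
- move=> s t _ _; rewrite -(mlim_mul L1 L2 L3) // -(mlim_sub L1 L2 L3) //; last exact: mbounded_mul.
  apply: (mlim_frob_le L1 L2 L3 L4) => //.
    by apply: mbounded_sub => //; exact: mbounded_mul.
  apply: (evle [:: s; t]) => k sk; rewrite add0r.
  by apply: (approx_mul (A k)); apply: sk; rewrite !inE eqxx ?orbT.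
- move=> s _; have bs1 := mbounded_mul (bpi s) bW.
  have bs2 := mbounded_mul bW (bU s).
  have -> : mlim L W *m U s = mlim L (fun k => W k *m U s).
    by rewrite (mlim_mul L1 L2 L3 bW (bU s)) mlim_cst.
  rewrite -(mlim_mul L1 L2 L3) // -(mlim_sub L1 L2 L3) // addr0.
  apply: (mlim_frob_le L1 L2 L3 L4); first exact: mbounded_sub.
    by rewrite mulr_ge0 ?addr_ge0 ?sqrtr_ge0.
  apply: (evle [:: s]) => k sk; apply: (approx_intertwine (A k)).
  by apply: sk; rewrite inE.
- apply: (mlim_frob_ge L1 L2 L3 L4) => // k; exact: approx_norm (A k).
- move=> p B; rewrite -{1}(mlim_cst L1 B) -(mlim_mul L1 L2 L3) //; last exact: mbounded_cst.
  apply: (mlim_frob_le L1 L2 L3 L4); [|exact: frob_ge0|].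
    by apply: mbounded_mul => //; exact: mbounded_cst.
  move=> e e0; exists 0%N => k _; apply: (le_trans (approx_contrL (A k) B)).
  by rewrite lerDl ltW.
- move=> p B; rewrite -(mlim_ctr L1 L2) // -{1}(mlim_cst L1 B) -(mlim_mul L1 L2 L3) //;
    [|exact: mbounded_ctr|exact: mbounded_cst].
  apply: (mlim_frob_le L1 L2 L3 L4); [|exact: frob_ge0|].
    by apply: mbounded_mul => //; [exact: mbounded_ctr | exact: mbounded_cst].
  move=> e e0; exists 0%N => k _; apply: (le_trans (approx_contrR (A k) B)).
  by rewrite lerDl ltW.
Qed.

End Limit.

(** * Small invariant subspaces *)

Section InvariantSubspaces.
Variable R : realType.
Local Notation K := (cplx R).
Variables (G : groupType) (m : nat) (pi : G -> 'M[K]_m).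
Hypothesis piM : forall g k, pi g *m pi k = pi (g * k)%g.
Hypothesis pi1 : pi 1%g = 1%:M.

(** An eigenvector of the restriction of [f] to [Y]. *)
Lemma stable_eigenvector (Y f : 'M[K]_m) : Y != 0 -> stablemx Y f ->
  exists a, (Y :&: eigenspace f a)%MS != 0.
Proof.
move=> Y0 Yf; have rY : (0 < \rank Y)%N by rewrite lt0n mxrank_eq0.
have [w w0 wf] : exists2 w : 'rV_(\rank Y), w != 0 & stablemx w (restrictmx Y f).
  have [a /eigenvalueP[w wa w0]] := eigenvalue_closed (restrictmx Y f) rY.
  by exists w => //; rewrite wa scalemx_sub.
rewrite stablemx_restrict // in wf; have /eigenvectorP[a wa] := wf.
exists a; apply/rowV0Pn; exists (w *m row_base Y).
  by rewrite sub_capmx wa andbT mulmx_sub // eq_row_base.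
by rewrite mulmx_free_eq0 ?row_base_free.
Qed.

(** A subspace of least positive dimension among those stable under commuting
  operators lies in one eigenspace of each of them. *)
Lemma common_eigenspace (H : {pred G}) (V : 'M[K]_m) :
    {in H &, forall x y : G, commute x y} -> V != 0 ->
    (forall h, h \in H -> stablemx V (pi h)) ->
  exists Y : 'M[K]_m, [/\ Y != 0, (Y <= V)%MS &
    forall h, h \in H -> exists a, (Y <= eigenspace (pi h) a)%MS].
Proof.
move=> Hab V0 VH.
pose good r := `[< exists Y : 'M[K]_m, [/\ Y != 0, (Y <= V)%MS, \rank Y = r &
  forall h, h \in H -> stablemx Y (pi h)] >].
have exg : exists r, good r by exists (\rank V); apply/asboolP; exists V; split.
case: (ex_minnP exg) => r /asboolP[Y [Y0 YV rY YH]] rmin.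
exists Y; split=> // h hH; have [a Ya] := stable_eigenvector Y0 (YH h hH).
exists a; set Z := (Y :&: eigenspace (pi h) a)%MS in Ya.
have rZ : (r <= \rank Z)%N.
  apply: rmin; apply/asboolP; exists Z; split=> //.
    exact: submx_trans (capmxSl _ _) YV.
  move=> k kH; rewrite sub_capmx.
  rewrite (submx_trans (submxMr _ (capmxSl _ _)) (YH k kH)) /=.
  apply: submx_trans (submxMr _ (capmxSr _ _)) _.
  by apply: comm_mx_stable_eigenspace; rewrite /comm_mx !piM Hab.
apply: submx_trans (capmxSr Y _); rewrite -(geq_leqif (mxrank_leqif_sup _)) ?capmxSl //.
by rewrite rY.
Qed.

(** A vector [v] on which [H] acts by scalars has at most [#|I|] translates up to
  scalars: every [x] is [(h * (r i)^-1)%g] with [h] in [H]. *)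
Lemma small_invariant (H : {pred G}) (I : finType) (c : G -> I) (r : I -> G)
    (V : 'M[K]_m) :
    {in H &, forall x y : G, commute x y} -> group_closed H ->
    cancel r c -> (forall x y, c x = c y <-> (x^-1 * y)%g \in H) ->
    V != 0 -> (forall g, stablemx V (pi g)) ->
  exists Z : 'M[K]_m,
    [/\ Z != 0, (Z <= V)%MS, (\rank Z <= #|I|)%N & forall g, stablemx Z (pi g)].
Proof.
move=> Hab Hgrp rK cE V0 VG; have HV := group_closedV Hgrp.
have [Y [Y0 YV Yeig]] := common_eigenspace Hab V0 (fun h _ => VG h).
pose v := nz_row Y; have v0 : v != 0 by rewrite nz_row_eq0.
have vY : (v <= Y)%MS := nz_row_sub Y.
pose Z := (\sum_i <<v *m pi (r i)^-1%g>>)%MS.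
have vZ x : (v *m pi x <= Z)%MS.
  pose i := c x^-1%g; have hH : (x * r i)%g \in H.
    by rewrite -[x]invgK; apply/cE; rewrite rK.
  have [a /(submx_trans vY) /eigenspaceP va] := Yeig _ hH.
  apply: (sumsmx_sup i) => //; rewrite genmxE -[x](mulgK (r i)) -piM mulmxA va.
  by rewrite -scalemxAl scalemx_sub.
exists Z; split.
- apply/negP => /eqP Z0; move: v0; rewrite -submx0 -Z0.
  by rewrite -[v]mulmx1 -pi1 vZ.
- apply/sumsmx_subP => i _; rewrite genmxE.
  apply: submx_trans (VG (r i)^-1%g); apply: submxMr.
  exact: submx_trans vY YV.
- apply: leq_trans (mxrank_sum_leqif _).1 _ => /=; rewrite -sum1_card.
  by apply: leq_sum => i _; rewrite genmxE rank_leq_row.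
- move=> g; rewrite sumsmxMr; apply/sumsmx_subP => i _.
  by rewrite (eqmxMr _ (genmxE _)) -mulmxA piM vZ.
Qed.

Hypothesis piU : forall g, pi g *m (pi g)^t* = 1%:M.

Lemma pi_ctr g : (pi g)^t* = pi g^-1%g.
Proof.
by rewrite -[LHS]mul1mx -pi1 -(mulVg g) -piM -mulmxA piU mulmx1.
Qed.

Lemma ortho_stable (Z : 'M[K]_m) g : stablemx Z (pi g^-1%g) ->
  stablemx (kermx (Z^t*)) (pi g).
Proof.
move=> /submxP[D ZD]; apply/sub_kermxP.
have e : pi g *m Z^t* = Z^t* *m D^t*.
  by rewrite -ctrM -ZD ctrM -pi_ctr trmxCK.
by rewrite -mulmxA e mulmxA mulmx_ker mul0mx.
Qed.

(** Invariant subspaces are enlarged in steps of at most [#|I|]: as long as there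
  is room, the orthogonal complement contributes a small invariant subspace. *)
Lemma invariant_frame (H : {pred G}) (I : finType) (c : G -> I) (r : I -> G) (k : nat) :
    {in H &, forall x y : G, commute x y} -> group_closed H ->
    cancel r c -> (forall x y, c x = c y <-> (x^-1 * y)%g \in H) ->
    (k <= m)%N ->
  exists l (J : 'M[K]_(l, m)), [/\ J \is unitarymx, (l <= k)%N, (k < l + #|I|)%N &
    forall g, stablemx J (pi g)].
Proof.
move=> Hab Hgrp rK cE km.
have I0 : (0 < #|I|)%N by apply/card_gt0P; exists (c 1%g).
pose good l := `[< exists Z : 'M[K]_m, [/\ \rank Z = l, (l <= k)%N &
  forall g, stablemx Z (pi g)] >].
have exg : exists l, good l.
  exists 0%N; apply/asboolP; exists 0; split=> [||g] //; first exact: mxrank0.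
  by rewrite mul0mx sub0mx.
have bnd l : good l -> (l <= k)%N by move=> /asboolP[Z []].
case: (ex_maxnP exg bnd) => l /asboolP[Z [rZ lk Zst]] lmax.
have lk' : (k < l + #|I|)%N.
  rewrite ltnNge; apply/negP => lIk.
  have lm : (l < m)%N.
    by apply: leq_trans km; apply: leq_trans lIk; rewrite -addn1 leq_add2l.
  have [|g|Z' [Z'0 Z'Z rZ' Z'st]] := @small_invariant H I c r (kermx (Z^t*)) Hab Hgrp rK cE.
  - by rewrite -mxrank_eq0 mxrank_ker mxrank_map mxrank_tr rZ -lt0n subn_gt0.
  - by apply: ortho_stable.
  have : good (\rank (Z + Z')%MS).
    apply/asboolP; exists (Z + Z')%MS; split=> //.
      apply: leq_trans (mxrank_adds_leqif _ _).1 _; rewrite rZ.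
      by apply: leq_trans lIk; rewrite leq_add2l.
    by move=> g; rewrite addsmxMr addsmxS.
  move=> /lmax; rewrite -rZ (geq_leqif (mxrank_leqif_sup _)) ?addsmxSl // addsmx_sub.
  case/andP=> _ /submxP[D Z'D]; case/eqP: Z'0; apply: frob_eq0.
  by rewrite /frob /frob_dot {2}Z'D ctrM mulmxA (sub_kermxP Z'Z) mul0mx mxtrace0 re0 sqrtr0.
pose J := schmidt (row_base Z).
have JZ : (J :=: Z)%MS.
  by apply: eqmx_trans (eqmx_schmidt_free (row_base_free Z)) (eq_row_base Z).
exists (\rank Z), J; split; rewrite ?rZ //.
  by apply: schmidt_unitarymx; rewrite rank_leq_col.
by move=> g; rewrite (eqmxMr _ JZ) JZ; exact: Zst.
Qed.

End InvariantSubspaces.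

(** * Adjusting the dimension *)

Section Transport.
Variable R : realType.
Local Notation C := (cplx R).
Variables (G : groupType) (m : nat) (pi : G -> 'M[C]_m).
Hypothesis piM : forall g k, pi g *m pi k = pi (g * k)%g.
Hypothesis piU : forall g, pi g *m (pi g)^t* = 1%:M.
Hypothesis pi1 : pi 1%g = 1%:M.

(** The complement of an invariant subspace of a unitary representation is
  invariant. *)
Lemma stable_proj l (J : 'M[C]_(l, m)) g : J *m J^t* = 1%:M ->
  (forall g, stablemx J (pi g)) -> pi g *m (J^t* *m J) = J^t* *m J *m pi g.
Proof.
move=> JJ Jst; pose Q := J^t* *m J.
have JQ k : J *m pi k *m Q = J *m pi k.
  have /submxP[D ->] := Jst k.
  by rewrite /Q mulmxA -(mulmxA D) JJ mulmx1.
have QQ k : Q *m pi k *m Q = Q *m pi k.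
  by rewrite /Q -!mulmxA; congr (_ *m _); rewrite !mulmxA -mulmxA JQ.
have Qh : Q^t* = Q by rewrite /Q ctrM trmxCK.
have QQ' : Q *m pi g *m Q = pi g *m Q.
  have := congr1 (fun A : 'M_m => A^t*) (QQ g^-1%g).
  rewrite (ctrM (Q *m _) Q) (ctrM Q) Qh (pi_ctr piM pi1 piU) invgK.
  by rewrite mulmxA.
by rewrite -/Q -QQ' QQ.
Qed.

(** A unitary representation with an invariant subspace of dimension [l <= n] acts
  on [C^n]: through a partial isometry [L] onto that subspace, and trivially on
  the complement. *)
Lemma transport_rep l n (J : 'M[C]_(l, m)) : J *m J^t* = 1%:M ->
    (forall g, stablemx J (pi g)) -> (l <= n)%N ->
  exists (rho : G -> 'M[C]_n) (L : 'M[C]_(m, n)),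
  [/\ forall g k, rho g *m rho k = rho (g * k)%g,
      forall g, rho g *m (rho g)^t* = 1%:M,
      forall p (A : 'M_(m, p)), frob (L^t* *m A) = frob (J *m A),
      forall p (A : 'M_(n, p)), frob (L *m A) <= frob A &
      forall g, rho g *m L^t* = L^t* *m pi g].
Proof.
move=> JJ Jst ln; pose E : 'M[C]_(l, n) := pid_mx l; pose L := J^t* *m E.
have EE : E *m E^t* = 1%:M.
  by rewrite tr_pid_mx map_pid_mx mul_pid_mx minnn (minn_idPr ln) pid_mx_1.
have Lc : L^t* = E^t* *m J by rewrite ctrM trmxCK.
pose Q := J^t* *m J; have LL : L *m L^t* = Q.
  by rewrite Lc /L mulmxA -(mulmxA _ E) EE mulmx1.
have QL : Q *m L = L by rewrite /Q /L !mulmxA -(mulmxA _ J) JJ mulmx1.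
have Qh : Q^t* = Q by rewrite /Q ctrM trmxCK.
have LQ : L^t* *m Q = L^t* by rewrite -[in LHS]Qh -ctrM QL.
have piQ g : pi g *m Q = Q *m pi g by exact: stable_proj.
pose F := 1%:M - L^t* *m L.
have LF : L *m F = 0 by rewrite mulmxBr mulmx1 mulmxA LL QL subrr.
have FL : F *m L^t* = 0 by rewrite mulmxBl mul1mx -mulmxA LL LQ subrr.
have Fh : F^t* = F by rewrite ctrB ctr1 ctrM trmxCK.
have FF : F *m F = F by rewrite {1}/F mulmxBl mul1mx -mulmxA LF mulmx0 subr0.
pose rho g := L^t* *m pi g *m L + F.
have rhoL g : rho g *m L^t* = L^t* *m pi g.
  by rewrite mulmxDl FL addr0 -mulmxA LL -mulmxA piQ mulmxA LQ.
have rhoF g : rho g *m F = F by rewrite mulmxDl FF -mulmxA LF mulmx0 add0r.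
exists rho, L; split=> //.
- move=> g k; rewrite {2}/rho mulmxDr rhoF mulmxA mulmxA rhoL.
  by rewrite -(mulmxA _ (pi g)) piM.
- move=> g; rewrite {2}/rho ctrD Fh mulmxDr rhoF (ctrM (_ *m _) L) (ctrM (L^t*)) (trmxCK L).
  rewrite mulmxA rhoL mulmxA -(mulmxA _ (pi g)) piU mulmx1.
  by rewrite /F addrC subrK.
- move=> p A; rewrite Lc -mulmxA frob_isoL // trmxCK; exact: EE.
- move=> p A; rewrite /L -mulmxA frob_isoL; last by rewrite trmxCK.
  have EE' : (E^t*)^t* *m E^t* = 1%:M by rewrite trmxCK.
  by have := frob_coiso_le A EE'; rewrite trmxCK.
Qed.

End Transport.

Section Stability.
Variable R : realType.
Local Notation C := (cplx R).

(** [X = L^t* *m W] intertwines [rho] and [U] as well as [W] does. It is a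
  contraction, for which being nearly isometric amounts to a norm close to that of a
  unitary: restricting to the invariant subspace costs at most its codimension
  [m - l], as [W^t*] is a contraction. *)
Lemma compress_equal_dim (G : groupType) n (U : G -> 'M[C]_n) (eps : R) (H : {pred G})
    (d : nat) m (pi : G -> 'M[C]_m) (W : 'M[C]_(m, n)) :
    group_closed H -> {in H &, forall x y : G, commute x y} ->
    (left_cosets H #<= `I_d)%card -> 0 <= eps ->
    (forall S, approx_rep U eps S 0 pi W) ->
  exists (rho : G -> 'M[C]_n) (X : 'M[C]_n),
  [/\ forall g k, rho g *m rho k = rho (g * k)%g,
      forall g, rho g *m (rho g)^t* = 1%:M,
      forall g, frob (rho g *m X - X *m U g) <=
        (Num.sqrt (6 * eps) + eps) * Num.sqrt n%:R &
      frob (X^t* *m X - 1%:M) <= Num.sqrt (6 * d.+1%:R * eps) * Num.sqrt n%:R].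
Proof.
move=> Hgrp Hab Hd eps0 A.
have [I [c [r [Id rK cE]]]] := coset_model Hgrp Hd.
have e0 a : frob a <= 0 -> a = 0 :> 'M[C]_m.
  by move=> le; apply: frob_eq0; apply/eqP; rewrite eq_le le frob_ge0.
have piU g : pi g *m (pi g)^t* = 1%:M.
  apply/eqP; rewrite -subr_eq0; apply/eqP/e0; apply: (approx_unitary (A [:: g])).
  by rewrite inE.
have piM g k : pi g *m pi k = pi (g * k)%g.
  apply/eqP; rewrite -subr_eq0; apply/eqP/e0; apply: (approx_mul (A [:: g; k])).
    by rewrite inE eqxx.
  by rewrite !inE eqxx orbT.
have pi1 : pi 1%g = 1%:M.
  have := piM 1%g 1%g; rewrite mulg1 => /(congr1 (mulmx^~ ((pi 1%g)^t*))).
  by rewrite -mulmxA piU mulmx1.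
have [l [J [JJ ln Jst lm]]] : exists l (J : 'M[C]_(l, m)), [/\ J *m J^t* = 1%:M,
    (l <= n)%N, forall g, stablemx J (pi g) &
    m%:R - l%:R <= d%:R * `|m%:R - n%:R| :> R].
  have [mn|nm] := leqP m n.
    exists m, 1%:M; split=> //; first by rewrite ctr1 mulmx1.
      by move=> g; exact: submx1.
    by rewrite subrr mulr_ge0.
  have [l [J [/unitarymxP JJ ln lI Jst]]] :=
    invariant_frame piM pi1 piU Hab Hgrp rK cE (ltnW nm).
  exists l, J; split=> //.
  have mn1 : (1 : R) <= m%:R - n%:R by rewrite -natrB ?(ltnW nm) // ler1n subn_gt0.
  rewrite ger0_norm; last by apply: le_trans mn1.
  have nl : n%:R + 1 <= l%:R + d%:R :> R.
    by rewrite natr1 -natrD ler_nat; apply: leq_trans lI _; rewrite leq_add2l.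
  have d1 : (1 : R) <= d%:R.
    by rewrite ler1n; apply: leq_trans Id; apply/card_gt0P; exists (c 1%g).
  have : 0 <= (d%:R - 1) * (m%:R - n%:R - 1) :> R by rewrite mulr_ge0 ?subr_ge0.
  by move: nl; clear; move: (m%:R) (n%:R) (l%:R) (d%:R) => *; lra.
have [rho [L [rhoM rhoU LJ Lc rhoL]]] := transport_rep piM piU pi1 JJ Jst ln.
have A0 := A [::].
exists rho, (L^t* *m W); split=> //.
- move=> g; rewrite mulmxA rhoL -!mulmxA -mulmxBr LJ.
  have J' : (J^t*)^t* *m J^t* = 1%:M by rewrite trmxCK.
  have := frob_coiso_le (pi g *m W - W *m U g) J'; rewrite trmxCK => /le_trans; apply.
  by rewrite -[leRHS]addr0; apply: (approx_intertwine (A [:: g])); rewrite inE.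
- set X := L^t* *m W.
  have J' : (J^t*)^t* *m J^t* = 1%:M by rewrite trmxCK.
  have X1 : (1 - 6 * eps) * n%:R - (m%:R - l%:R) <= frob X ^+ 2.
    have pW := frob_pythagoras W J'; rewrite trmxCK in pW.
    have p1 := frob_pythagoras (1%:M : 'M[C]_m) J'; rewrite trmxCK !mulmx1 in p1.
    have fJ : frob_dot J J = l%:R by rewrite -sqr_frob frob_unitary //; exact/unitarymxP.
    have WP : frob (W - J^t* *m J *m W) <= frob (1%:M - J^t* *m J).
      have -> : W - J^t* *m J *m W = (1%:M - J^t* *m J) *m W by rewrite mulmxBl mul1mx.
      rewrite -frob_ctr ctrM ctrB ctr1 ctrM trmxCK.
      exact: approx_contrR A0 _ _.
    rewrite LJ sqr_frob; rewrite frob_dot1 fJ in p1.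
    have := approx_norm A0; rewrite sqr_frob pW.
    move: WP; rewrite -ler_sqr ?nnegrE ?frob_ge0 // !sqr_frob; move: p1.
    by move: (frob_dot _ _) (frob_dot _ _) (frob_dot _ _); clear=> *; lra.
  have X2 : frob (X^t* *m X) <= frob X.
    rewrite ctrM trmxCK -mulmxA; apply: le_trans (approx_contrR A0 _) _.
    exact: Lc.
  have s0 : 0 <= Num.sqrt (6 * d.+1%:R * eps) * Num.sqrt n%:R.
    by rewrite mulr_ge0 ?sqrtr_ge0.
  rewrite frob_le // frob_dotDl !frob_dotDr !frob_dotNl !frob_dotNr frob_dot1.
  rewrite exprMn (@sqr_sqrtr _ n%:R) ?ler0n // sqr_sqrtr; last first.
    by rewrite mulr_ge0 // mulr_ge0 ?ler0n.
  have e1 : frob_dot (X^t* *m X) 1%:M = frob X ^+ 2.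
    by rewrite frob_dot_ctrL trmxCK mulmx1 sqr_frob.
  rewrite (frob_dotC 1%:M) e1 -sqr_frob.
  have : frob (X^t* *m X) ^+ 2 <= frob X ^+ 2.
    by rewrite ler_sqr ?nnegrE ?frob_ge0.
  have dm : m%:R - l%:R <= d%:R * (6 * eps * n%:R) :> R.
    by apply: le_trans lm _; rewrite ler_wpM2l ?ler0n //; exact: approx_dim A0.
  rewrite -[d.+1%:R]natr1 => XX.
  have num (x y k N D : R) : (1 - 6 * eps) * N - k <= y ->
      k <= D * (6 * eps * N) -> x <= y ->
      x - y + (- y - - N) <= 6 * (D + 1) * eps * N by clear; lra.
  exact: num X1 dm XX.
Qed.

End Stability.

(** * Stability *)

Section Representation.
Variable R : realType.
Local Notation C := (cplx R).

(** With [Y] the unitary part of [X], the error is that of [X] as an intertwiner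
  plus twice the distance from [X] to [Y]. *)
Lemma near_representation (G : groupType) (H : {pred G}) (d n : nat)
    (U : G -> 'M[C]_n) (s eps : R) :
    countable [set: G] -> group_closed H ->
    {in H &, forall x y : G, commute x y} -> (left_cosets H #<= `I_d)%card ->
    (0 < n)%N -> 0 < s -> s <= 1 -> eps = s ^+ 2 / (6 * d.+1%:R) ->
    (forall g, U g \is unitarymx) ->
    (forall g k, frob (U g *m U k - U (g * k)%g) <= eps * Num.sqrt n%:R) ->
  exists V : G -> 'M[C]_n,
  [/\ forall g, V g \is unitarymx, forall g k, V g *m V k = V (g * k)%g &
      forall g, frob (U g - V g) <= 6 * s * Num.sqrt n%:R].
Proof.
move=> cG Hgrp Hab Hd n0 s0 s1 epsE Uu Uhom.
have D0 : (0 : R) < 6 * d.+1%:R by rewrite mulr_gt0 ?ltr0n.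
have Deps : 6 * d.+1%:R * eps = s ^+ 2 by rewrite epsE mulrC divfK // gt_eqF.
have eps0 : 0 <= eps by rewrite epsE divr_ge0 ?sqr_ge0 ?ltW.
have le6 : 6 * eps <= s ^+ 2.
  by rewrite -Deps ler_wpM2r // ler_peMr ?ler0n // ler1n.
have eps_s : eps <= s.
  have e6 : eps <= 6 * eps by rewrite ler_peMl // ler1n.
  by apply: le_trans e6 (le_trans le6 _); rewrite expr2 ler_piMl // ltW.
have sq6 : Num.sqrt (6 * eps) <= s.
  by rewrite -[leRHS](gtr0_norm s0) -sqrtr_sqr ler_wsqrtr.
have sqD : Num.sqrt (6 * d.+1%:R * eps) = s by rewrite Deps sqrtr_sqr gtr0_norm.
set q := Num.sqrt n%:R in Uhom *.
have q0 : 0 < q by rewrite sqrtr_gt0 ltr0n.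
have [m [pi [W A]]] := limit_rep cG eps0
  (approx_rep_exists (folner Hgrp Hab Hd) eps0 Uu Uhom).
have [rho [X [rhoM rhoU rhoX XX]]] := compress_equal_dim Hgrp Hab Hd eps0 A.
have sq0 : 0 < s * q by rewrite mulr_gt0.
have [Y Yu YX] := polar_near X sq0.
have YY := unitarymxP Yu; have YY' := mulmx1C YY.
exists (fun g => Y^t* *m rho g *m Y); split=> [g|g k|g].
- apply/unitarymxP; rewrite !ctrM trmxCK !mulmxA.
  by rewrite -(mulmxA _ Y) YY mulmx1 -(mulmxA _ (rho g)) rhoU mulmx1.
- by rewrite -rhoM !mulmxA -(mulmxA _ Y) YY mulmx1.
rewrite -(frob_isoL _ YY') mulmxBr !mulmxA YY mul1mx frobBC.
apply: le_trans (frob_trans (rho g *m X) _ _) _.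
apply: le_trans (lerD (lexx _) (frob_trans (X *m U g) _ _)) _.
rewrite -mulmxBr -mulmxBl (frob_isoR _ (unitarymxP (Uu g))).
have rhoU' : (rho g)^t* *m rho g = 1%:M := mulmx1C (rhoU g).
rewrite (frob_isoL _ rhoU') (frobBC Y X).
have h1 : frob (X - Y) <= s * q + s * q.
  by apply: le_trans YX _; rewrite lerD2r; apply: le_trans XX _; rewrite sqD.
have h2 : frob (rho g *m X - X *m U g) <= (s + s) * q.
  by apply: le_trans (rhoX g) _; rewrite ler_wpM2r ?(ltW q0) // lerD.
by move: (frob _) (frob _) h1 h2; clear=> x y; lra.
Qed.

End Representation.

Theorem corollary1p7 (R : realType) (d : nat) :
  uniformly_stable R (countable_abelian_index_le d).
Proof.
move=> delta delta0.
(* The error of [near_representation] is [6 * s < delta]; [s <= 1] ensures that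
   [eps <= s]. *)
pose s : R := Num.min 1 (delta / 8).
have s0 : 0 < s by rewrite lt_min ltr01 divr_gt0.
have s1 : s <= 1 by rewrite ge_min lexx.
have sd : 8 * s <= delta by rewrite mulrC -ler_pdivlMr // ge_min lexx orbT.
pose eps : R := s ^+ 2 / (6 * d.+1%:R).
exists eps; first by rewrite divr_gt0 ?exprn_gt0 // mulr_gt0 ?ltr0n.
move=> G [cG [H [Hgrp Hab Hd]]] n n0 phi phi_hom.
have q0 : 0 < Num.sqrt n%:R :> R by rewrite sqrtr_gt0 ltr0n.
have hsE (A : 'M[R[i]]_n) : hs_norm A = frob (A : 'M[cplx R]_n) / Num.sqrt n%:R.
  by rewrite hs_norm_frob sqrtrV ?ler0n // mulrC.
pose U g : 'M[cplx R]_n := unitary_val (phi g).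
have Uu g : U g \is unitarymx by exact: unitary_valP (phi g).
have Uhom g k : frob (U g *m U k - U (g * k)%g) <= eps * Num.sqrt n%:R.
  have := ltW (phi_hom g k); rewrite /hs_dist hsE ler_pdivrMr //.
have [V [Vu VM UV]] := near_representation cG Hgrp Hab Hd n0 s0 s1 erefl Uu Uhom.
pose pi g : unitary_group R n := UnitaryGroup (Vu g).
have piM : {morph pi : x y / (x * y)%g}.
  by move=> x y; apply: val_inj; rewrite /= -VM.
pose piH := isMultiplicative.Build G (unitary_group R n) pi piM.
pose piMor : {multiplicative G -> unitary_group R n} := HB.pack pi piH.
exists piMor => g; rewrite /hs_dist hsE ltr_pdivrMr //.
apply: le_lt_trans (UV g) _; rewrite ltr_pM2r //.
by move: s0 sd; clear; lra.
Qed.
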